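(* Let $M$ be a complex manifold of complex dimension $n$ with an ALE Kähler metric $g$ whose Kähler potential has the form $$\Phi=\frac{1}{2}|z|^{2}+a|z|^{-2\alpha}+O(|z|^{-2\alpha-1}),$$ where $\alpha>0$ and $a\in\mathbb{R}$, in holomorphic asymptotic coordinates $z=(z_1,\dots,z_n)$ at infinity. Then, whatever the sign of the mass $\mathfrak{m}(M,g)$, $(M,g)$ does not admit a Kähler immersion into the complex hyperbolic space $\mathbb{C}H^{N}$, for any $N\leq\infty$.
   Context: ALE: a complete connected non-compact Riemannian manifold $(M,g)$ of real dimension $d$ is asymptotically locally Euclidean (ALE) if the complement of some compact set $K$ consists of finitely many components, each diffeomorphic to a quotient $(\mathbb{R}^{d}-D^{d})/\Gamma_j$, where $D^d$ is a closed ball and $\Gamma_j\subset O(d)$ is a finite subgroup acting freely on the unit sphere, in such a way that $g$ becomes the Euclidean metric plus error terms that fall off sufficiently rapidly at infinity (rapidly enough for the mass to be well defined). Here $d=2n$, and $g$ is Kähler with respect to the complex structure $J$ of $M$. Potential: $z$ denotes holomorphic coordinates on the asymptotic region, taking values in the complement of a ball in $\mathbb{C}^n$ (modulo the finite group), $|z|^2=\sum_{i=1}^n|z_i|^2$, and $\Phi$ is a Kähler potential for $g$ there. The notation $O(|z|^{-2\alpha-1})$ means a term $f(z,\bar z)$ such that $f(z,\bar z)/|z|^{-2\alpha-1}$ is bounded for $|z|$ large. Kähler potentials are normalized so that $|w|^2=\sum_j |w_j|^2$ is a potential of the flat metric on $\mathbb{C}^N$. Mass: for an ALE Kähler manifold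 $(M,g,J)$ of complex dimension $m$ (here $m=n$), the mass is given by $$\mathfrak{m}(M,g)=-\frac{\langle \clubsuit(c_1),[\omega]^{m-1}\rangle}{(2m-1)\pi^{m-1}}+\frac{(m-1)!}{4(2m-1)\pi^{m}}\int_M s_g\,d\mu_g,$$ where $s_g$ and $d\mu_g$ are the scalar curvature and volume form of $g$, $c_1=c_1(M,J)\in H^2(M)$ is the first Chern class, $[\omega]\in H^2(M)$ is the Kähler class of $g$, $\clubsuit:H^2(M)\to H^2_c(M)$ is the inverse of the natural map $H^2_c(M)\to H^2(M)$ induced by inclusion of compactly supported forms into all forms (an isomorphism in the ALE setting), and $\langle\,,\rangle$ is the duality pairing between $H^2_c(M)$ and $H^{2m-2}(M)$. The conclusion is asserted whether the mass is positive, zero or negative. Kähler immersion: a Kähler immersion of a Kähler manifold $(M,g)$ into a complex space form $(S,g_S)$ is a holomorphic map $f:M\to S$ with $f^*g_S=g$. The complex hyperbolic space $\mathbb{C}H^N$, $N\le\infty$, is the unit ball $\{(w_j)\in\mathbb{C}^N:\sum_{j=1}^N|w_j|^2<1\}$ (with $\mathbb{C}^\infty=\ell^2(\mathbb{C})$) endowed with the hyperbolic metric of constant holomorphic sectional curvature $-4$, i.e. the Kähler metric with potential $-\log(1-\sum_{j}|w_j|^2)$. *)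

(* Defs.v *)
From HB Require Import structures.
From mathcomp Require Import all_boot all_order all_algebra.
From mathcomp Require Import complex.
From mathcomp Require Import all_classical all_reals all_analysis.

Set Implicit Arguments.
Unset Strict Implicit.
Unset Printing Implicit Defensive.

Import Order.TTheory GRing.Theory Num.Theory numFieldNormedType.Exports.

Local Open Scope classical_set_scope.
Local Open Scope ring_scope.
Local Open Scope complex_scope.

(* R[i] as a normed space over itself, so that 'rV[R[i]]_n has its usual
   topology and [differentiable] means complex Frechet differentiable. *)
HB.instance Definition _ (R : realType) := NormedModule.copy R[i] R[i]^o.

(** * Real and complex calculus *)

(* Derivative of a real-valued function on a complex vector space in the real
   direction v.  Locked because a failing conversion test that unfolds it is
   prohibitively slow. *)
HB.lock Definition ddir (R : realType) (V : lmodType R[i]) (u : V -> R)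
    (x v : V) : R :=
  derive1 (fun t : R => u (x + t%:C *: v)) 0.

Section Calculus.
Variable R : realType.

(* The symmetric J-invariant bilinear form with values
   sum_jk (d^2 Phi / dz_j dzbar_k) v_j conj(v_k) on the diagonal.  It is the
   Kaehler metric with potential Phi, in the normalization in which |z|^2 is a
   potential of the flat metric. *)
Definition levi (V : lmodType R[i]) (Phi : V -> R) (x v w : V) : R :=
  4^-1 * (ddir (fun y => ddir Phi y v) x w
          + ddir (fun y => ddir Phi y ('i%C *: v)) x ('i%C *: w)).

Definition rlinear (V : lmodType R[i]) (f : V -> R) : Prop :=
  forall (t : R) (u v : V), f (t%:C *: u + v) = t * f u + f v.

Definition C1 (u : R -> R) : Prop :=
  (forall t, derivable u t 1) /\ continuous (derive1 u : R -> R).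

Variable n : nat.
Local Notation V := 'rV[R[i]]_n.

(* The real Euclidean structure of C^n = R^2n. *)
Definition dotR (v w : V) : R :=
  \sum_k (complex.Re (v 0 k) * complex.Re (w 0 k)
          + complex.Im (v 0 k) * complex.Im (w 0 k)).

Definition enorm (v : V) : R := Num.sqrt (dotR v v).

Definition exterior (r : R) : set V := [set x | r < enorm x].

Fixpoint Ck (k : nat) (U : set V) (u : V -> R) : Prop :=
  if k is k'.+1 then
    (forall x v, U x -> derivable (fun t : R => u (x + t%:C *: v)) 0 1) /\
    (forall v, Ck k' U (fun x => ddir u x v))
  else forall x, U x -> u @ x --> u x.

Definition smooth (U : set V) (u : V -> R) : Prop := forall k, Ck k U u.

Definition smooth_map (U : set V) (F : V -> V) : Prop :=
  forall k, smooth U (fun x => complex.Re (F x 0 k)) /\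
            smooth U (fun x => complex.Im (F x 0 k)).

(* Real differential of F at x, applied to v. *)
Definition vder (F : V -> V) (x v : V) : V :=
  \row_k (ddir (fun y => complex.Re (F y 0 k)) x v
          +i* ddir (fun y => complex.Im (F y 0 k)) x v).

(* Matrix of the Hermitian form (linear in the first variable) whose real part
   is the symmetric J-invariant real form B. *)
Definition herm (B : V -> V -> R) : 'M[R[i]]_n :=
  \matrix_(j, k) (B (delta_mx 0 j) (delta_mx 0 k)
                  +i* B (delta_mx 0 j) ('i%C *: delta_mx 0 k)).

(* Sum of B(e_a, e_a) over a unitary frame (e_a) of H. *)
Definition htrace (H B : V -> V -> R) : R :=
  complex.Re (\tr (invmx (herm H) *m herm B)).

(* Finite subgroup of O(2n) acting freely on the unit sphere. *)
Definition free_orthogonal_group (G : set (V -> V)) : Prop :=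
  [/\ finite_set G,
      G id,
      (forall a b, G a -> G b -> G (a \o b)) /\
      (forall a, G a -> exists2 b, G b & a \o b = id),
      (forall a, G a ->
         (forall (t : R) u v, a (t%:C *: u + v) = t%:C *: a u + a v) /\
         (forall v, enorm (a v) = enorm v)) &
      (forall a x, G a -> enorm x = 1 -> a x = x -> a = id)].

Definition borelC := g_sigma_algebraType (@open V).

(* Lebesgue measure on C^n = R^2n, determined by its values on open boxes. *)
Definition is_lebesgueC (la : {measure set borelC -> \bar R}) : Prop :=
  forall a b : V,
    (forall k, complex.Re (a 0 k) <= complex.Re (b 0 k)
               /\ complex.Im (a 0 k) <= complex.Im (b 0 k)) ->
    la [set z : V | forall k,
          (complex.Re (a 0 k) < complex.Re (z 0 k) < complex.Re (b 0 k)) /\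
          (complex.Im (a 0 k) < complex.Im (z 0 k) < complex.Im (b 0 k))]
    = (\prod_k ((complex.Re (b 0 k) - complex.Re (a 0 k))
                * (complex.Im (b 0 k) - complex.Im (a 0 k))))%:E.

End Calculus.

(** * Complex manifolds *)

(* The carrier is pointed only because the measure theory of the library is
   developed for pointed types. *)
Record complexManifold (R : realType) (n : nat) := ComplexManifold {
  carrier :> ptopologicalType;
  cix : Type;
  dom : cix -> set carrier;
  chart : cix -> carrier -> 'rV[R[i]]_n;
  chart_inv : cix -> 'rV[R[i]]_n -> carrier;
  mfd_hausdorff : hausdorff_space carrier;
  mfd_second_countable : @second_countable carrier;
  dom_open : forall i, open (dom i);
  dom_cover : forall p, exists i, dom i p;
  img_open : forall i, open (chart i @` dom i);
  chartK : forall i p, dom i p -> chart_inv i (chart i p) = p;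
  chart_continuous : forall i p, dom i p -> chart i @ p --> chart i p;
  chart_inv_continuous : forall i p, dom i p ->
    chart_inv i @ chart i p --> chart_inv i (chart i p);
  transition_holomorphic : forall i j p, dom i p -> dom j p ->
    differentiable (chart j \o chart_inv i) (chart i p)
}.

Section Manifold.
Variables (R : realType) (n : nat) (M : complexManifold R n).
Local Notation V := 'rV[R[i]]_n.

Definition img (i : cix M) : set V := chart i @` dom i.

Definition transition (i j : cix M) : V -> V := chart j \o chart_inv i.

(* Tensor fields are given by their local expressions in the charts; the
   arguments of [tensor2] are chart, point, and two real tangent vectors. *)
Definition tensor1 := cix M -> V -> V -> R.
Definition tensor2 := cix M -> V -> V -> V -> R.

Definition is_tensor1 (b : tensor1) : Prop :=
  [/\ (forall i x, img i x -> rlinear (b i x)),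
      (forall i v, smooth (img i) (fun x => b i x v)) &
      (forall i j p v, dom i p -> dom j p ->
         b i (chart i p) v
         = b j (chart j p) (vder (transition i j) (chart i p) v))].

Definition is_tensor2 (T : tensor2) : Prop :=
  [/\ (forall i x v, img i x ->
         rlinear (T i x v) /\ rlinear (fun u => T i x u v)),
      (forall i v w, smooth (img i) (fun x => T i x v w)) &
      (forall i j p v w, dom i p -> dom j p ->
         T i (chart i p) v w
         = T j (chart j p) (vder (transition i j) (chart i p) v)
                           (vder (transition i j) (chart i p) w))].

Definition is_form2 (th : tensor2) : Prop :=
  is_tensor2 th /\ (forall i x v, img i x -> th i x v v = 0).

Definition closed_form2 (th : tensor2) : Prop :=
  forall i x u v w, img i x ->
    ddir (fun y => th i y v w) x u + ddir (fun y => th i y w u) x v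
    + ddir (fun y => th i y u v) x w = 0.

Definition d_form1 (b : tensor1) : tensor2 := fun i x v w =>
  ddir (fun y => b i y w) x v - ddir (fun y => b i y v) x w.

Definition compactly_supported (th : tensor2) : Prop :=
  exists2 K : set M, compact K &
    forall i p v w, dom i p -> ~ K p -> th i (chart i p) v w = 0.

(* u is the function on M with local expressions F. *)
Definition represents (F : cix M -> V -> R) (u : M -> R) : Prop :=
  forall i p, dom i p -> u p = F i (chart i p).

Definition borelM := g_sigma_algebraType (@open M).

(* h = E^* T on U. *)
Definition is_pullback (T : tensor2) (E : V -> M) (U : set V)
    (h : V -> V -> V -> R) : Prop :=
  forall i x v w, U x -> dom i (E x) ->
    h x v w = T i (chart i (E x)) (vder (chart i \o E) x v)
                                  (vder (chart i \o E) x w).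

Definition local_diffeo (U : set V) (E : V -> M) : Prop :=
  forall x, U x -> (E @ x --> E x) /\
    forall i, dom i (E x) ->
      (exists2 W, open_nbhs x W & smooth_map W (chart i \o E)) /\
      (forall v, vder (chart i \o E) x v = 0 -> v = 0).

(* The complement of the compact set K has the m components
   E_j(exterior (r_j)), and E_j induces a diffeomorphism from
   (exterior (r_j)) / G_j onto its image, i.e. E_j is a local diffeomorphism
   whose fibres are the G_j-orbits. *)
Definition asymptotic_ends (K : set M) (m : nat) (E : 'I_m -> V -> M)
    (r : 'I_m -> R) (G : 'I_m -> set (V -> V)) : Prop :=
  [/\ compact K,
      (forall j, 0 < r j /\ free_orthogonal_group (G j)),
      (forall j, local_diffeo (exterior (r j)) (E j)),
      (forall j k x y, exterior (r j) x -> exterior (r k) y ->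
         (E j x = E k y <-> j = k /\ exists2 a, G j a & y = a x)) &
      (forall p, ~ K p <-> exists j, (E j @` exterior (r j)) p)].

Definition holomorphic_on (U : set V) (E : V -> M) : Prop :=
  forall i x, U x -> dom i (E x) -> differentiable (chart i \o E) x.

End Manifold.

(** * Kaehler metrics *)

(* The (real) metric tensor; the Kaehler form is (v, w) |-> g(Jv, w). *)
Record kahlerMetric (R : realType) (n : nat) (M : complexManifold R n) :=
  KahlerMetric {
  met :> cix M -> 'rV[R[i]]_n -> 'rV[R[i]]_n -> 'rV[R[i]]_n -> R;
  met_tensor : is_tensor2 met;
  met_sym : forall i x v w, img i x -> met i x v w = met i x w v;
  met_J : forall i x v w, img i x ->
    met i x ('i%C *: v) ('i%C *: w) = met i x v w;
  met_pos : forall i x v, img i x -> v != 0 -> 0 < met i x v v;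
  met_closed : closed_form2 (fun i x v w => met i x ('i%C *: v) w)
}.

Section Kahler.
Variables (R : realType) (n : nat) (M : complexManifold R n).
Variable g : kahlerMetric M.
Local Notation V := 'rV[R[i]]_n.

(* p and q are joined by a C^1 curve of length l contained in a chart. *)
Definition C1_arc (p q : M) (l : R) : Prop :=
  exists (i : cix M) (c : R -> V),
    let c' t := \row_k (derive1 (fun s => complex.Re (c s 0 k)) t
                        +i* derive1 (fun s => complex.Im (c s 0 k)) t) in
    [/\ (forall k, C1 (fun s => complex.Re (c s 0 k))
                   /\ C1 (fun s => complex.Im (c s 0 k))),
        (forall t, 0 <= t <= 1 -> img i (c t)),
        p = chart_inv i (c 0), q = chart_inv i (c 1) &
        l = Rintegral lebesgue_measure `[0, 1]
              (fun t => Num.sqrt (g i (c t) (c' t) (c' t)))].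

Inductive joined : M -> M -> R -> Prop :=
| joined_refl p : joined p p 0
| joined_step p q s l l' :
    C1_arc p q l -> joined q s l' -> joined p s (l + l').

(* Cauchy sequences for the Riemannian distance converge. *)
Definition complete_metric : Prop :=
  forall u : nat -> M,
    (forall e : R, 0 < e -> exists N, forall j k, (N <= j)%N -> (N <= k)%N ->
       exists2 l, l < e & joined (u j) (u k) l) ->
    exists q : M, u @ \oo --> q.

(* The real metric g has volume density det (herm g) with respect to Lebesgue
   measure of R^2n. *)
Definition hdet (i : cix M) (x : V) : R := complex.Re (\det (herm (g i x))).

Definition is_volume (mu : {measure set (borelM M) -> \bar R}) : Prop :=
  exists2 la : {measure set (borelC R n) -> \bar R}, is_lebesgueC la &
    forall i (A : set (borelM M)), measurable A -> A `<=` dom i ->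
      mu A = (\int[la]_(z in (chart i @` A : set (borelC R n)))
                (hdet i z)%:E)%E.

(* The Ricci form is - i ddbar log det (g_jk); in the normalization of [levi],
   Ric = - 2 levi (log det (g_jk)). *)
Definition ricci : tensor2 M := fun i x v w =>
  - 2 * levi (fun y => ln (hdet i y)) x v w.

Definition scalar_curvature (i : cix M) (x : V) : R :=
  2 * htrace (g i x) (ricci i x).

(* The form Ric(J., .) / 2 pi representing c_1. *)
Definition chern_form : tensor2 M := fun i x v w =>
  (2 * pi)^-1 * ricci i x ('i%C *: v) w.

(* Lambda th, where th /\ omega^(n-1) = (n-1)! (Lambda th) dmu_g. *)
Definition Lambda (th : tensor2 M) (i : cix M) (x : V) : R :=
  htrace (g i x)
    (fun v w => 2^-1 * (th i x v ('i%C *: w) + th i x w ('i%C *: v))).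

(* th is a closed compactly supported form cohomologous to the Chern form,
   i.e. a representative of the compactly supported class club(c_1). *)
Definition is_mass (m : R) : Prop :=
  exists (mu : {measure set (borelM M) -> \bar R}) (s l : M -> R)
         (th : tensor2 M) (b : tensor1 M),
    [/\ is_volume mu,
        represents scalar_curvature s
        /\ mu.-integrable setT (fun p => (s p)%:E),
        [/\ is_form2 th, closed_form2 th & compactly_supported th],
        is_tensor1 b /\ (forall i x v w, img i x ->
          th i x v w = chern_form i x v w + d_form1 b i x v w) &
        represents (Lambda th) l
        /\ m = - ((n.-1)`!%:R * Rintegral mu setT l)
                 / ((2 * n%:R - 1) * pi ^+ n.-1)
               + (n.-1)`!%:R / (4 * (2 * n%:R - 1) * pi ^+ n)
                 * Rintegral mu setT s].

Definition mass : R := xget 0 [set m | is_mass m].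

(* g becomes Euclidean at infinity, with the usual fall-off conditions under
   which the mass is defined: in the asymptotic coordinates
   g - g_0 = O(|x|^-tau) and dg = O(|x|^(-tau-1)) for some
   tau > (real dimension)/2 - 1, and the scalar curvature is integrable. *)
Definition ALE : Prop :=
  [/\ connected [set: M],
      ~ compact [set: M],
      complete_metric,
      (exists (K : set M) (m : nat) (E : 'I_m -> V -> M) (r : 'I_m -> R)
              (G : 'I_m -> set (V -> V)),
         asymptotic_ends K E r G /\
         forall j, exists (h : V -> V -> V -> R) (tau : R),
           [/\ is_pullback g (E j) (exterior (r j)) h,
               n%:R - 1 < tau &
               forall u v w, exists C rho : R, forall x,
                 exterior (r j) x -> rho < enorm x ->
                 `|h x v w - dotR v w| <= C * enorm x `^ (- tau) /\
                 `|ddir (fun y => h y v w) x u|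
                   <= C * enorm x `^ (- tau - 1)]) &
      exists (mu : {measure set (borelM M) -> \bar R}) (s : M -> R),
        [/\ is_volume mu, represents scalar_curvature s &
            mu.-integrable setT (fun p => (s p)%:E)]].

(* Phi is a Kaehler potential of g on the asymptotic region, with expansion
   |z|^2/2 + a |z|^(-2 alpha) + O(|z|^(-2 alpha - 1)) in holomorphic asymptotic
   coordinates z.  These coordinates need not be the ones used in [ALE]: for
   the normalization of [levi], g is asymptotic to half the Euclidean metric
   in z. *)
Definition has_asymptotic_potential (a alpha : R) : Prop :=
  exists (K : set M) (m : nat) (E : 'I_m -> V -> M) (r : 'I_m -> R)
         (G : 'I_m -> set (V -> V)) (Phi : M -> R),
    asymptotic_ends K E r G /\
    forall j, let U := exterior (r j) in
      [/\ holomorphic_on U (E j),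
          smooth U (Phi \o E j),
          is_pullback g (E j) U (levi (Phi \o E j)) &
          exists C rho : R, forall z, U z -> rho < enorm z ->
            `|Phi (E j z) - (2^-1 * enorm z ^+ 2
                             + a * enorm z `^ (- 2 * alpha))|
              <= C * enorm z `^ (- 2 * alpha - 1)].

End Kahler.

(** * Complex hyperbolic space *)

Section Hyperbolic.
Variable R : realType.
Local Notation S := (nat -> R[i]).

Definition sqnorm (w : S) : \bar R :=
  (\sum_(0 <= j <oo)
     (complex.Re (w j) ^+ 2 + complex.Im (w j) ^+ 2)%R%:E)%E.

(* The unit ball of l^2 for N = None (dimension infinity); for N = Some N0, the
   unit ball of C^N0, seen as the sequences supported in {0, ..., N0 - 1}. *)
Definition CH (N : option nat) : set S :=
  [set w | (sqnorm w < 1)%E /\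
           (if N is Some N0 then forall j, (N0 <= j)%N -> w j = 0 else True)].

Definition hyp_potential (w : S) : R := - ln (1 - fine (sqnorm w)).

Definition hyp_metric (w u v : S) : R := levi hyp_potential w u v.

(* L is the complex Frechet differential at x of the l^2-valued map F. *)
Definition l2_differential (n : nat) (F : 'rV[R[i]]_n -> S)
    (x : 'rV[R[i]]_n) (L : 'rV[R[i]]_n -> S) : Prop :=
  [/\ (forall (c : R[i]) u v, L (c *: u + v) = c *: L u + L v),
      (forall v, (sqnorm (L v) < +oo)%E) &
      (forall e : R, 0 < e -> \forall y \near x,
         (sqnorm (F y - F x - L (y - x))%R <= (e * enorm (y - x) ^+ 2)%R%:E)%E)].

Definition kahler_immersion (n : nat) (M : complexManifold R n)
    (g : kahlerMetric M) (N : option nat) (f : M -> S) : Prop :=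
  (forall p, CH N (f p)) /\
  (forall (i : cix M) x, img i x -> exists2 L,
     l2_differential (f \o chart_inv i) x L &
     forall v w, g i x v w = hyp_metric (f (chart_inv i x)) (L v) (L w)).

End Hyperbolic.

(* Main.v *)
Require Import Defs.
From mathcomp Require Import all_boot all_order all_algebra.
From mathcomp Require Import complex.
From mathcomp Require Import all_classical all_reals all_analysis.
From mathcomp Require Import ring lra.
Set Implicit Arguments.
Unset Strict Implicit.
Unset Printing Implicit Defensive.
Import Order.TTheory GRing.Theory Num.Theory numFieldNormedType.Exports.
Import Normc.
Local Open Scope classical_set_scope.
Local Open Scope ring_scope.
Local Open Scope complex_scope.



(** On an end the potential is asymptotic to half of |z|^2, so the metric is
    flat at infinity on average; a holomorphic map into the unit ball, on the
    other hand, must contract more and more far out.  These two facts already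
    contradict each other on a single complex line of the asymptotic chart.

    Let F be the immersion restricted to such a line, that is, to the points
    of absolute value larger than r, let u be its derivative and lam the length
    squared of u in the hyperbolic metric.  Around a point z0 the disc of
    radius s < |z0| - r is mapped into the unit ball, and a Schwarz lemma
    ([hyp_metric_schwarz]) gives lam z0 <= 5 / s^2.  As the immersion is
    isometric, lam is a quarter of the Laplacian of the potential phi along the
    line.  Choose z0 far out and s comparable to |z0|: on the disc of radius s
    around z0 the function phi(z) - |z|^2 / 2 + |z - z0|^2 / 4 has negative
    Laplacian, so its minimum is on the boundary ([laplacian_min_principle]);
    since phi - |z|^2 / 2 is bounded, this bounds s, which is absurd.

    The Schwarz lemma needs the mean value property of holomorphic functions,
    but an immersion is only supposed to be complex differentiable at each
    point, with no continuity of the derivative.  What replaces the continuity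
    is a local bound on u: |u|^2 <= lam, and lam is continuous because it is
    computed from the smooth potential.  With such a bound one differentiates
    the mean over a circle with respect to the radius under the integral sign;
    by the Cauchy-Riemann equation the result is the mean of the angular
    derivative of a periodic function, hence zero ([circle_mean_ge0]). *)

(** * Differentiation of the mean of a periodic function *)

Section PeriodicMean.
Variable R : realType.
Local Notation mu := (@lebesgue_measure R).
Implicit Types (f : R -> R -> R) (w : R -> R) (T : R).

Lemma continuous_integrable_segment w (a b : R) : continuous w ->
  mu.-integrable `[a, b] (EFin \o w).
Proof.
move=> cw; apply: continuous_compact_integrable; first exact: segment_compact.
exact: continuous_subspaceT.
Qed.

(** The integral of w over [h, h + T] is F (h + T) - F h for a primitive F, whose
    derivative w (h + T) - w h vanishes by periodicity. *)
Lemma is_derive_shift_mean0 w T : 0 < T -> continuous w ->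
  (forall y, w (y + T) = w y) ->
  is_derive (0 : R) 1 (fun h => \int[mu]_(y in `[0, T]) w (y + h)) 0.
Proof.
move=> T0 cw wT.
(* The base point -2 lies to the left of h for all h in ]-1, 1[. *)
pose F (x : R) : R := \int[mu]_(y in `[-2, x]) w y.
have dF (x : R) : -2 < x -> is_derive x 1 F (w x).
  move=> x2; have [dFx F'x] : derivable F x 1 /\ derive1 F x = w x.
    apply: (@continuous_FTC1 R w (BLeft (-2)) x (x + 1)); rewrite ?ltrDl//.
      exact: continuous_integrable_segment.
    exact: cw.
  by apply: DeriveDef; [exact: dFx|rewrite -derive1E].
have dFs (h x : R) : -2 < x + h -> is_derive x 1 (fun x => F (x + h)) (w (x + h)).
  move=> xh; have dFxh := dF _ xh.
  have := @is_derive1_comp R F (shift h) x _ _ dFxh (is_derive_shift x 1 h).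
  by rewrite mulr1.
have Fint (h : R) : -1 < h < 1 ->
    \int[mu]_(y in `[0, T]) w (y + h) = F (T + h) - F h.
  move=> /andP[h1 h2].
  rewrite /Rintegral (@continuous_FTC2 R (fun x => w (x + h)) (fun x => F (x + h)) 0 T)//=.
  - by rewrite add0r.
  - apply: continuous_subspaceT => x; apply: continuous_comp => /=.
      by apply: continuousD => //; exact: cst_continuous.
    exact: cw.
  - have cFs (x : R) : -2 < x + h -> (F (y + h) @[y --> x] --> F (x + h)).
      move=> xh; have dFx := dFs h x xh.
      by have /derivable1_diffP/differentiable_continuous := @ex_derive _ _ _ _ _ _ _ dFx.
    split => /=.
    + move=> x; rewrite in_itv /= => /andP[x0 xT].
      have xh : -2 < x + h by lra.
      by have dFx := dFs h x xh; exact: ex_derive.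
    + by apply: cvg_at_right_filter; apply: cFs; lra.
    + by apply: cvg_at_left_filter; apply: cFs; lra.
  - move=> x; rewrite in_itv /= => /andP[x0 xT].
    have xh : -2 < x + h by lra.
    by have dFx := dFs h x xh; rewrite derive1E derive_val.
have dFT : is_derive (0 : R) 1 (fun h => F (T + h) - F h) 0.
  have d1 : is_derive (0:R) 1 (fun h => F (h + T)) (w (0 + T)) by apply: dFs; lra.
  have d2 : is_derive (0:R) 1 F (w 0) by apply: dF; lra.
  have -> : (fun h => F (T + h) - F h) = (fun h => F (h + T)) - F.
    by apply: funext => h; rewrite [T + h]addrC.
  by apply: is_derive_eq; rewrite wT subrr.
apply: (near_eq_is_derive _ dFT).
near=> h; apply/esym/Fint.
rewrite -ltr_norml.
by near: h; exact: (@nbhs0_lt R R^o).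
Unshelve. all: by end_near. Qed.

(** Differentiating under the integral sign turns the derivative of the mean of f
    into the mean of w', and the latter is also what one gets by differentiating
    the constant mean of the translates of w.  Both steps rest on bounds on the
    derivatives instead of their continuity, because this is applied to complex
    functions that are only known to be differentiable. *)
Lemma is_derive_periodic_mean0 f w (T u v x : R) (B : R) : 0 < T -> u < x < v ->
  (forall r : R, u < r < v -> continuous (f r)) ->
  (forall r y : R, u < r < v -> exists2 d, is_derive r 1 (f^~ y) d & `|d| <= B) ->
  (forall y, w (y + T) = w y) ->
  (forall y : R, exists2 d, is_derive y 1 w d & `|d| <= B) ->
  (forall y d : R, is_derive y 1 w d -> is_derive x 1 (f^~ y) d) ->
  is_derive x 1 (fun r => \int[mu]_(y in `[0, T]) f r y) 0.
Proof.
move=> T0 xI cf df wT dw dwf.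
have mT : measurable (`[0, T] : set (measurableTypeR R)) by exact: measurable_itv.
have iB : mu.-integrable `[0, T] (EFin \o (fun _ : R => B)).
  by apply: continuous_integrable_segment => ?; exact: cvg_cst.
have B0 : 0 <= B by have [d _] := dw 0; exact: le_trans.
have cw : continuous w.
  move=> y; have [d dy _] := dw y.
  by have /derivable1_diffP/differentiable_continuous := @ex_derive _ _ _ _ _ _ _ dy.
have xI' : (`]u, v[%classic : set R) x by rewrite /= in_itv.
have h1 : forall x : R, `]u, v[%classic x -> mu.-integrable `[0, T] (EFin \o f x).
  by move=> r rI; apply: continuous_integrable_segment; apply: cf; move: rI; rewrite /= in_itv.
have h2 : forall x y : R, `]u, v[%classic x -> `[0, T]%classic y -> derivable (f ^~ y) x 1.
  move=> r y rI _; have [|d dr _] := df r y; first by move: rI; rewrite /= in_itv.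
  exact: ex_derive.
have h3 : forall x y : R, `]u, v[%classic x -> `[0, T]%classic y -> `|partial1of2 f x y| <= B.
  move=> r y rI _; have [|d dr] := df r y; first by move: rI; rewrite /= in_itv.
  by rewrite partial1of2E derive_val.
have dM := derivable_under_integral mT xI' h1 h2 (fun _ => B0) iB h3.
have vM := differentiation_under_integral mT xI' h1 h2 (fun _ => B0) iB h3.
apply: DeriveDef; first exact: dM.
rewrite -derive1E vM.
pose g (h y : R) : R := w (y + h).
have dg (h y : R) : exists2 d, is_derive h 1 (g^~ y) d & `|d| <= B.
  have [d dy dB] := dw (h + y); exists d; last exact: dB.
  have := @is_derive1_comp R w (shift y) h _ _ dy (is_derive_shift h 1 y).
  rewrite mulr1; congr is_derive; apply/funext => z /=.
  by rewrite /g addrC.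
have I0 : (`](-1), 1[%classic : set R) 0 by rewrite /= in_itv /=; apply/andP; split; lra.
have k1 : forall x : R, `](-1), 1[%classic x -> mu.-integrable `[0, T] (EFin \o g x).
  move=> h _; apply: continuous_integrable_segment => y; apply: continuous_comp => /=.
    by apply: continuousD => //; exact: cst_continuous.
  exact: cw.
have k2 : forall x y : R, `](-1), 1[%classic x -> `[0, T]%classic y -> derivable (g ^~ y) x 1.
  by move=> h y _ _; have [d dr _] := dg h y; exact: ex_derive.
have k3 : forall x y : R, `](-1), 1[%classic x -> `[0, T]%classic y -> `|partial1of2 g x y| <= B.
  by move=> h y _ _; have [d dr] := dg h y; rewrite partial1of2E derive_val.
have := differentiation_under_integral mT I0 k1 k2 (fun _ => B0) iB k3.
have d0 := is_derive_shift_mean0 T0 cw wT.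
rewrite derive1E derive_val => e0; rewrite [RHS]e0.
apply: eq_Rintegral => y _.
have [d dy _] := dw y; rewrite !partial1of2E.
have dxy := dwf _ _ dy; rewrite derive_val.
have dy0 : is_derive (0 + y) 1 w d by rewrite add0r.
have dg0 := @is_derive1_comp R w (shift y) 0 _ _ dy0 (is_derive_shift 0 1 y).
have -> : g^~ y = w \o shift y by apply/funext => z; rewrite /g /= addrC.
by rewrite derive_val mulr1.
Qed.

End PeriodicMean.

(** * The modulus of a complex number as a real number *)

Section Modulus.
Variable R : realType.
Local Notation C := R[i].
Implicit Types z : C.

Lemma normcR z : `|z| = (normc z)%:C.
Proof. by []. Qed.

Lemma normc_ge0 z : 0 <= normc z.
Proof. by case: z => a b; rewrite /normc sqrtr_ge0. Qed.

Lemma normc_triangle (x y : C) : normc (x + y) <= normc x + normc y.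
Proof. exact: le_normcD. Qed.

Lemma normc_opp (x : C) : normc (- x) = normc x.
Proof. exact: normcN. Qed.

Lemma sqr_normcE z : normc z ^+ 2 = complex.Re z ^+ 2 + complex.Im z ^+ 2.
Proof. by case: z => a b; rewrite /normc sqr_sqrtr ?addr_ge0 ?sqr_ge0. Qed.

Lemma normc_Re_le z : `|complex.Re z| <= normc z.
Proof. by rewrite -lecR; exact: normc_ge_Re. Qed.

Lemma normc_Im_le z : `|complex.Im z| <= normc z.
Proof.
rewrite -(ler_sqr (normr_ge0 _) (normc_ge0 _)) sqr_normcE real_normK ?num_real//.
by rewrite lerDr sqr_ge0.
Qed.

Lemma normc_le_ReIm z : normc z <= `|complex.Re z| + `|complex.Im z|.
Proof.
rewrite -ler_sqr ?nnegrE ?normc_ge0 ?addr_ge0// sqr_normcE sqrrD !real_normK ?num_real//.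
by rewrite lerD2r lerDl mulrn_wge0 ?mulr_ge0.
Qed.

Lemma Re_le_normc z : complex.Re z <= normc z.
Proof. exact: le_trans (ler_norm _) (normc_Re_le z). Qed.

Lemma normc_real (x : R) : normc x%:C = `|x|.
Proof. by rewrite /normc /= expr0n /= addr0 sqrtr_sqr. Qed.

Lemma normc_eq0E z : (normc z == 0) = (z == 0).
Proof.
apply/eqP/eqP => [/eq0_normc //|->]; exact: normc0.
Qed.

Lemma normc_gt0 z : (0 < normc z) = (z != 0).
Proof. by rewrite lt_neqAle normc_ge0 andbT eq_sym normc_eq0E. Qed.

End Modulus.

(** * Complex derivatives and derivatives of plane curves *)

Section DerivativeEstimate.

(** Multiplying out the difference quotient avoids excluding the increment 0, which
    matters when the increment is that of a curve. *)
Lemma is_derive_estimateP (K : numFieldType) (W : normedModType K)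
    (f : K -> W) (t : K) (d : W) :
  is_derive t 1 f d <->
  forall e : K, 0 < e ->
    \forall s \near (0 : K), `|f (t + s) - f t - s *: d| <= e * `|s|.
Proof.
split=> [fd e e0|fd].
  have cf : h^-1 *: (f (h *: 1 + t) - f t) @[h --> 0^'] --> d.
    by rewrite -(@derive_val _ _ _ _ _ _ _ fd); exact: (@ex_derive _ _ _ _ _ _ _ fd).
  have cf' : \forall s \near (0 : K), s != 0 ->
      `|d - s^-1 *: (f (s *: 1 + t) - f t)| <= e.
    by move/cvgrPdist_le : cf => /(_ _ e0).
  move: cf'; apply: filterS => s.
  have [-> _|s0 /(_ isT) le_e] := eqVneq s 0.
    by rewrite addr0 subrr scale0r subr0 !normr0 mulr0 lexx.
  have -> : f (t + s) - f t - s *: d = - (s *: (d - s^-1 *: (f (s *: 1 + t) - f t))).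
    rewrite scalerBr scalerA divff// scale1r opprB.
    by rewrite [s%:A]mulr1 [s + t]addrC.
  by rewrite normrN normrZ mulrC ler_wpM2r.
have cf : h^-1 *: ((f \o shift t) (h *: 1) - f t) @[h --> 0^'] --> d.
  apply/cvgrPdist_le => e e0.
  suff : \forall s \near (0 : K), s != 0 ->
      `|d - s^-1 *: (f (s *: 1 + t) - f t)| <= e by [].
  have := fd e e0; apply: filterS => s sle s0.
  have -> : d - s^-1 *: (f (s *: 1 + t) - f t) = - (s^-1 *: (f (t + s) - f t - s *: d)).
    by rewrite [in RHS]scalerBr scalerA mulVf// scale1r opprB [s%:A]mulr1 [s + t]addrC.
  rewrite normrN normrZ normfV mulrC ler_pdivrMr ?normr_gt0//.
apply: DeriveDef; first by apply/cvg_ex; exists d; exact: cf.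
by apply/cvg_lim; [exact: norm_hausdorff|exact: cf].
Qed.

Variable R : realType.
Local Notation C := R[i].


Lemma complex_is_derive_estimate (H : C -> C) (z d : C) (e : R) : 0 < e ->
  is_derive z 1 H d ->
  exists2 r : R, 0 < r & forall h, normc h < r ->
    normc (H (z + h) - H z - d * h) <= e * normc h.
Proof.
move=> e0 /is_derive_estimateP/(_ e%:C).
rewrite ltcR => /(_ e0)/nbhs_normP[r /= r0 rP].
have rE : r = (complex.Re r)%:C by rewrite RRe_real// gtr0_real.
exists (complex.Re r); first by rewrite -ltcR -rE.
move=> h hr; have /rP : ball_ (@Num.norm _ _) 0 r h.
  by rewrite /ball_ /= sub0r normrN rE normcR ltcR.
by rewrite /= [h *: d]mulrC !normcR -rmorphM/= lecR.
Qed.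

(** [is_derive] does not apply to curves in the complex plane, because R[i] is
    normed over itself and not over the reals. *)
Definition curve_deriv (c : R -> C) (t : R) (c' : C) : Prop :=
  forall e : R, 0 < e ->
    \forall s \near (0 : R), normc (c (t + s) - c t - s%:C * c') <= e * `|s|.

Lemma Re_lin (x y z : C) (s : R) :
  complex.Re (x - y - s%:C * z) =
  complex.Re x - complex.Re y - s *: complex.Re z.
Proof. by case: x y z => a b [a' b'] [x y] /=; rewrite mul0r subr0. Qed.

Lemma Im_lin (x y z : C) (s : R) :
  complex.Im (x - y - s%:C * z) =
  complex.Im x - complex.Im y - s *: complex.Im z.
Proof. by case: x y z => a b [a' b'] [x y] /=; rewrite mul0r addr0. Qed.

Lemma curve_derivP (c : R -> C) (t : R) (c' : C) :
  curve_deriv c t c' <->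
  is_derive t 1 (fun s => complex.Re (c s)) (complex.Re c') /\
  is_derive t 1 (fun s => complex.Im (c s)) (complex.Im c').
Proof.
have ReE s : complex.Re (c (t + s) - c t - s%:C * c') =
    complex.Re (c (t + s)) - complex.Re (c t) - s *: complex.Re c'.
  exact: Re_lin.
have ImE s : complex.Im (c (t + s) - c t - s%:C * c') =
    complex.Im (c (t + s)) - complex.Im (c t) - s *: complex.Im c'.
  exact: Im_lin.
split=> [dc|[/is_derive_estimateP dX /is_derive_estimateP dY] e e0].
  split; apply/is_derive_estimateP => e e0; have := dc e e0; apply: filterS => s.
    by apply: le_trans; rewrite -ReE normc_Re_le.
  by apply: le_trans; rewrite -ImE normc_Im_le.
have e20 : 0 < e / 2 by rewrite divr_gt0.
have := dX _ e20; have := dY _ e20; apply: filterS2 => s Ys Xs.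
apply: le_trans (normc_le_ReIm _) _; rewrite ReE ImE.
by rewrite (le_trans (lerD Xs Ys))// -mulrDl -splitr.
Qed.

Lemma curve_deriv_comp (H : C -> C) (c : R -> C) (t : R) (c' d : C) :
  curve_deriv c t c' -> is_derive (c t) 1 H d ->
  curve_deriv (H \o c) t (d * c').
Proof.
move=> dc dH e e0.
(* M bounds the speed of the increments of c near t, and e1 M that of each of the
   two error terms. *)
pose M := normc c' + 1 + normc d.
have M0 : 0 < M by rewrite /M ltr_wpDr ?normc_ge0// ltr_wpDl ?normc_ge0.
pose e1 := Num.min 1 (e / (2 * M)).
have e10 : 0 < e1 by rewrite lt_min ltr01 divr_gt0// mulr_gt0.
have e11 : e1 <= 1 by rewrite ge_min lexx.
have e1M : e1 * M <= e / 2.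
  rewrite -ler_pdivlMr// -mulrA -invfM.
  by rewrite /e1 ge_min lexx orbT.
have [r r0 rP] := complex_is_derive_estimate e10 dH.
have hs : \forall s \near (0 : R), `|s| < r / M.
  by apply: (@nbhs0_lt R R^o); rewrite divr_gt0.
have := dc _ e10; apply: filterS2 hs => s sr dcs.
set h := c (t + s) - c t in dcs.
have hM : normc h <= M * `|s|.
  rewrite -[h](subrK (s%:C * c')) (le_trans (normc_triangle _ _))//.
  rewrite normcM normc_real /M.
  have := normc_ge0 d; have := normr_ge0 s; have := normc_ge0 c' => a1 a2 a3.
  have : e1 * `|s| <= `|s| by rewrite ler_piMl.
  by have := mulr_ge0 a3 a2; nra.
have hr : normc h < r.
  by rewrite (le_lt_trans hM)// mulrC -ltr_pdivlMr.
have := rP _ hr; rewrite /h [c t + _]addrC subrK -/h => Hh.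
have -> : (H \o c) (t + s) - (H \o c) t - s%:C * (d * c') =
    (H (c (t + s)) - H (c t) - d * h) + d * (h - s%:C * c').
  by rewrite /=; ring.
apply: le_trans (normc_triangle _ _) _.
rewrite normcM.
have := normc_ge0 d; have := normr_ge0 s; have := normc_ge0 c' => a1 a2 a3.
have b1 : e1 * normc h <= e1 * M * `|s| by rewrite -mulrA ler_wpM2l// ltW.
have b2 : normc d * normc (h - s%:C * c') <= e1 * M * `|s|.
  rewrite (le_trans (ler_wpM2l a3 dcs))// mulrA [e1 * M]mulrC.
  rewrite ler_wpM2r// ler_wpM2r ?(ltW e10)// /M; lra.
have b3 : e1 * M * `|s| <= e / 2 * `|s| by rewrite ler_wpM2r.
by rewrite (le_trans (lerD (le_trans Hh b1) b2))//; lra.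
Qed.

Lemma curve_deriv_ray (z : C) (r : R) : curve_deriv (fun r => r%:C * z) r z.
Proof.
move=> e e0; near=> s.
have -> : (r + s)%:C * z - r%:C * z - s%:C * z = 0.
  by rewrite rmorphD/=; ring.
by rewrite normc0 mulr_ge0// ltW.
Unshelve. all: by end_near. Qed.

Definition cexpi (t : R) : C := cos t +i* sin t.

Lemma normc_cexpi (t : R) : normc (cexpi t) = 1.
Proof. by rewrite /normc /= cos2Dsin2 sqrtr1. Qed.

Lemma curve_deriv_circle (r t : R) :
  curve_deriv (fun t => r%:C * cexpi t) t (r%:C * ('i%C * cexpi t)).
Proof.
apply/curve_derivP; split => /=.
  under eq_fun do rewrite mul0r subr0.
  rewrite !mul0r !mul1r !subr0 sub0r.
  exact: (@is_deriveZ _ _ _ _ r).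
under eq_fun do rewrite mul0r addr0.
rewrite !mul0r !mul1r !addr0 add0r.
exact: (@is_deriveZ _ _ _ _ r).
Qed.

End DerivativeEstimate.

(** * Means of holomorphic functions over circles *)

Section CircleMean.
Variable R : realType.
Local Notation C := R[i].
Local Notation mu := (@lebesgue_measure R).

Lemma cexpiD2pi (t : R) : cexpi (t + pi *+ 2) = cexpi t.
Proof. by rewrite /cexpi sinD2pi cosD2pi. Qed.

Lemma curve_deriv_Re (c : R -> C) t c' : curve_deriv c t c' ->
  is_derive t 1 (fun s => complex.Re (c s)) (complex.Re c').
Proof. by case/curve_derivP. Qed.

Lemma curve_deriv_Im (c : R -> C) t c' : curve_deriv c t c' ->
  is_derive t 1 (fun s => complex.Im (c s)) (complex.Im c').
Proof. by case/curve_derivP. Qed.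

Lemma is_derive_continuous (f : R -> R) (t d : R) : is_derive t 1 f d ->
  f @ t --> f t.
Proof.
by move=> fd; have /derivable1_diffP/differentiable_continuous :=
  @ex_derive _ _ _ _ _ _ _ fd.
Qed.

Lemma normc_polar (r t : R) : 0 <= r -> normc (r%:C * cexpi t) = r.
Proof. by move=> r0; rewrite normcM normc_real normc_cexpi mulr1 ger0_norm. Qed.

(** In polar coordinates the Cauchy-Riemann equation says that the radial
    derivative of Re H is the angular derivative of Im H divided by the radius;
    the latter is the derivative of a periodic function, and has mean zero. *)
Lemma is_derive_circle_mean0 (H dH : C -> C) (s0 x : R) : 0 < x < s0 ->
  (forall z, 0 < normc z < s0 -> is_derive z 1 H (dH z)) ->
  (forall r1 r2 : R, 0 < r1 -> r2 < s0 -> exists B : R, forall z,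
      r1 <= normc z <= r2 -> normc (dH z) <= B) ->
  is_derive x 1
    (fun r => \int[mu]_(y in `[0, pi *+ 2]) complex.Re (H (r%:C * cexpi y))) 0.
Proof.
move=> /andP[x0 xs] dHP dHB.
pose u := x / 2; pose v := (x + s0) / 2.
have u0 : 0 < u by rewrite divr_gt0.
have ux : u < x by rewrite /u; lra.
have xv : x < v by rewrite /v; lra.
have vs : v < s0 by rewrite /v; lra.
have [B BP] := dHB u v u0 vs.
have rad (r y : R) : 0 < r < s0 -> is_derive r 1
    (fun r => complex.Re (H (r%:C * cexpi y)))
    (complex.Re (dH (r%:C * cexpi y) * cexpi y)).
  move=> /andP[r0 rs]; apply: curve_deriv_Re.
  apply: (curve_deriv_comp (curve_deriv_ray (cexpi y) r)).
  by apply: dHP; rewrite normc_polar ?r0// ltW.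
have ang (r y : R) : 0 < r < s0 -> curve_deriv
    (fun y => H (r%:C * cexpi y)) y
    (dH (r%:C * cexpi y) * (r%:C * ('i%C * cexpi y))).
  move=> /andP[r0 rs].
  apply: (curve_deriv_comp (curve_deriv_circle r y)).
  by apply: dHP; rewrite normc_polar ?r0// ltW.
have angE (y : R) : x^-1 * complex.Im (dH (x%:C * cexpi y) * (x%:C * ('i%C * cexpi y)))
    = complex.Re (dH (x%:C * cexpi y) * cexpi y).
  case: (dH _) => a b /=; field; exact: lt0r_neq0.
have dw (y : R) : is_derive y 1 (fun y => x^-1 * complex.Im (H (x%:C * cexpi y)))
    (complex.Re (dH (x%:C * cexpi y) * cexpi y)).
  rewrite -angE; apply: (@is_deriveZ _ _ _ _ x^-1).
  by apply: curve_deriv_Im; apply: ang; rewrite x0.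
have bnd (r y : R) : u < r < v -> `|complex.Re (dH (r%:C * cexpi y) * cexpi y)| <= B.
  move=> /andP[ur rv]; rewrite (le_trans (normc_Re_le _))// normcM normc_cexpi mulr1.
  by apply: BP; rewrite normc_polar; lra.
apply: (@is_derive_periodic_mean0 R (fun r y => complex.Re (H (r%:C * cexpi y)))
  (fun y => x^-1 * complex.Im (H (x%:C * cexpi y))) (pi *+ 2) u v x B).
- by rewrite mulrn_wgt0 ?pi_gt0.
- by rewrite ux.
- move=> r /andP[ur rv] y; apply: is_derive_continuous.
  by apply: curve_deriv_Re; apply: ang; lra.
- move=> r y rI; exists (complex.Re (dH (r%:C * cexpi y) * cexpi y)); last exact: bnd.
  by apply: rad; move: rI; lra.
- by move=> y; rewrite cexpiD2pi.
- move=> y; exists (complex.Re (dH (x%:C * cexpi y) * cexpi y)); first exact: dw.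
  by apply: bnd; rewrite ux.
- move=> y d dd.
  rewrite -(@derive_val _ _ _ _ _ _ _ dd) (@derive_val _ _ _ _ _ _ _ (dw y)).
  by apply: rad; rewrite x0.
Qed.

(** The mean of Re H over the circles around 0 does not depend on the radius.  It is
    nonnegative at radius s, and tends to Re A when the radius tends to 0. *)
Lemma circle_mean_ge0 (H dH : C -> C) (A : C) (s0 s : R) : 0 < s < s0 ->
  (forall z, 0 < normc z < s0 -> is_derive z 1 H (dH z)) ->
  (forall r1 r2 : R, 0 < r1 -> r2 < s0 -> exists B : R, forall z,
      r1 <= normc z <= r2 -> normc (dH z) <= B) ->
  (forall e : R, 0 < e -> exists2 d : R, 0 < d & forall z,
      0 < normc z < d -> normc (H z - A) <= e) ->
  (forall z, normc z = s -> 0 <= complex.Re (H z)) ->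
  0 <= complex.Re A.
Proof.
move=> /andP[sp ss0] dHP dHB HA Hs.
pose M (r : R) : R := \int[mu]_(y in `[0, pi *+ 2]) complex.Re (H (r%:C * cexpi y)).
have dM (r : R) : 0 < r < s0 -> is_derive r 1 M 0.
  by move=> r0; exact: (is_derive_circle_mean0 r0 dHP dHB).
have Mcst (r : R) : 0 < r < s -> M r = M s.
  move=> /andP[r0 rs].
  have [||c _] := @MVT R M (fun=> 0) r s rs.
  - by move=> x; rewrite in_itv /= => /andP[rx xs]; apply: dM; lra.
  - apply: derivable_within_continuous => x; rewrite in_itv /= => /andP[rx xs].
    by have dx : is_derive x 1 M 0 by [apply: dM; lra]; exact: ex_derive.
  - by rewrite mul0r => /eqP; rewrite subr_eq0 => /eqP.
have Ms0 : 0 <= M s.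
  by apply: Rintegral_ge0 => y _; apply: Hs; rewrite normc_polar// ltW.
rewrite leNgt; apply/negP => A0.
pose e := - complex.Re A / 2.
have e0 : 0 < e by rewrite /e; lra.
have [d d0 dP] := HA _ e0.
pose r := Num.min (d / 2) (s / 2).
have r0 : 0 < r by rewrite lt_min !divr_gt0.
have rd : r < d by rewrite (@le_lt_trans _ _ (d / 2)) ?ge_min ?lexx//; lra.
have rs : r < s by rewrite (@le_lt_trans _ _ (s / 2)) ?ge_min ?lexx ?orbT//; lra.
have : M r < 0.
  have : M r <= \int[mu]_(y in `[0, pi *+ 2]) (- e).
    apply: le_Rintegral => //.
    - apply: continuous_integrable_segment => y; apply: is_derive_continuous.
      apply: curve_deriv_Re; apply: (curve_deriv_comp (curve_deriv_circle r y)).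
      by apply: dHP; rewrite normc_polar ?r0 ?(ltW r0)//; lra.
    - by apply: continuous_integrable_segment => y; exact: cvg_cst.
    - move=> y _.
      have /dP : 0 < normc (r%:C * cexpi y) < d by rewrite normc_polar ?r0 ?(ltW r0).
      have := Re_le_normc (H (r%:C * cexpi y) - A); rewrite raddfB /= /e; lra.
  move/le_lt_trans; apply.
  rewrite Rintegral_cst//= lebesgue_measure_itv /= lte_fin mulrn_wgt0 ?pi_gt0//= subr0.
  by rewrite mulNr oppr_lt0 mulr_gt0// mulrn_wgt0// pi_gt0.
by rewrite Mcst ?r0// ltNge Ms0.
Qed.

End CircleMean.

(** * Functions holomorphic on a disc *)

Section DiscFunctions.
Variable R : realType.
Local Notation C := R[i].

Lemma complex_is_derive_of_estimate (H : C -> C) (z d : C) :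
  (forall e : R, 0 < e -> exists2 r : R, 0 < r & forall h, normc h < r ->
    normc (H (z + h) - H z - d * h) <= e * normc h) ->
  is_derive z 1 H d.
Proof.
move=> HP; apply/is_derive_estimateP => e e0.
have eE : e = (complex.Re e)%:C by rewrite RRe_real// gtr0_real.
have [|r r0 rP] := HP (complex.Re e); first by rewrite -ltcR -eE.
apply/nbhs_normP; exists r%:C => /=; first by rewrite ltcR.
move=> h; rewrite /ball_ /= sub0r normrN normcR ltcR => /rP.
by rewrite [h *: d]mulrC eE !normcR -rmorphM/= lecR.
Qed.

Lemma is_derive_opp_comp (k : C -> C) (z d : C) :
  is_derive (- z) 1 k d -> is_derive z 1 (fun y => k (- y)) (- d).
Proof.
move=> dk; apply: complex_is_derive_of_estimate => e e0.
have [r r0 rP] := complex_is_derive_estimate e0 dk.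
exists r => // h hr; have := rP (- h); rewrite normc_opp => /(_ hr).
by rewrite opprD mulrN mulNr.
Qed.

Lemma is_derive_addl_comp (k : C -> C) (a z d : C) :
  is_derive (a + z) 1 k d -> is_derive z 1 (fun y => k (a + y)) d.
Proof.
move=> dk; apply: complex_is_derive_of_estimate => e e0.
have [r r0 rP] := complex_is_derive_estimate e0 dk.
by exists r => // h hr; have := rP h hr; rewrite addrA.
Qed.

Lemma complex_is_deriveM (f g : C -> C) (z df dg : C) :
  is_derive z 1 f df -> is_derive z 1 g dg ->
  is_derive z 1 (fun y => f y * g y) (f z * dg + g z * df).
Proof. by move=> fd gd; exact: (@is_deriveM C C f g z 1 df dg). Qed.

Lemma complex_is_deriveD (f g : C -> C) (z df dg : C) :
  is_derive z 1 f df -> is_derive z 1 g dg ->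
  is_derive z 1 (fun y => f y + g y) (df + dg).
Proof. by move=> fd gd; exact: (@is_deriveD C C C f g z 1 df dg). Qed.

Lemma complex_is_derive_cst (a z : C) : is_derive z 1 (fun _ : C => a) 0.
Proof. exact: (@is_derive_cst C C C). Qed.

Lemma complex_is_derive_id (z : C) : is_derive z 1 (fun y : C => y) 1.
Proof. exact: (@is_derive_id C C). Qed.

Lemma complex_is_deriveV (z : C) : z != 0 ->
  is_derive z 1 (fun y : C => y^-1) (- z ^- 2).
Proof.
move=> z0.
have did : derivable (fun y : C => y) z 1.
  exact: (@ex_derive _ _ _ _ _ _ _ (complex_is_derive_id z)).
apply: DeriveDef; first exact: (@derivableV C C (fun y => y) z 1 z0 did).
rewrite (@deriveV C C (fun y => y) z 1 z0 did).
by rewrite (@derive_val _ _ _ _ _ _ _ (complex_is_derive_id z)) [LHS]mulr1.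
Qed.

(** The bounds on smaller discs stand for the continuity of the derivative: they
    allow to differentiate under the integral sign, and they are stable under sums
    and products by constants. *)
Definition disc_holo (s0 : R) (k dk : C -> C) : Prop :=
  forall r : R, r < s0 -> exists B : R, forall z, normc z <= r ->
    [/\ is_derive z 1 k (dk z), normc (k z) <= B & normc (dk z) <= B].

Lemma disc_holo_derive s0 k dk z : disc_holo s0 k dk -> normc z < s0 ->
  is_derive z 1 k (dk z).
Proof. by move=> hk /hk[B /(_ z (lexx _))[]]. Qed.

Lemma disc_holo_cst s0 a : disc_holo s0 (fun=> a) (fun=> 0).
Proof.
move=> r _; exists (normc a) => z _; split=> //.
  exact: complex_is_derive_cst.
by rewrite normc0 normc_ge0.
Qed.

Lemma disc_holoD s0 k dk l dl : disc_holo s0 k dk -> disc_holo s0 l dl ->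
  disc_holo s0 (fun z => k z + l z) (fun z => dk z + dl z).
Proof.
move=> hk hl r rs; have [B BP] := hk r rs; have [B' BP'] := hl r rs.
exists (B + B') => z zr; have [d1 k1 k2] := BP z zr.
have [d2 l1 l2] := BP' z zr; split; first exact: complex_is_deriveD.
  exact: le_trans (normc_triangle _ _) (lerD _ _).
exact: le_trans (normc_triangle _ _) (lerD _ _).
Qed.

Lemma disc_holoZ s0 a k dk : disc_holo s0 k dk ->
  disc_holo s0 (fun z => a * k z) (fun z => a * dk z).
Proof.
move=> hk r rs; have [B BP] := hk r rs.
exists (normc a * B) => z zr; have [d1 k1 k2] := BP z zr; split.
- have := complex_is_deriveM (complex_is_derive_cst a z) d1.
  by rewrite mulr0 addr0.
- by rewrite normcM ler_wpM2l ?normc_ge0.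
- by rewrite normcM ler_wpM2l ?normc_ge0.
Qed.

Lemma disc_holo_sum s0 (J : nat) (k dk : nat -> C -> C) :
  (forall j, disc_holo s0 (k j) (dk j)) ->
  disc_holo s0 (fun z => \sum_(j < J) k j z) (fun z => \sum_(j < J) dk j z).
Proof.
move=> hk; elim: J => [|J IH].
  have -> : (fun z : C => \sum_(j < 0) k j z) = fun=> 0.
    by apply/funext => z; rewrite big_ord0.
  have -> : (fun z : C => \sum_(j < 0) dk j z) = fun=> 0.
    by apply/funext => z; rewrite big_ord0.
  exact: disc_holo_cst.
have -> : (fun z : C => \sum_(j < J.+1) k j z) =
    fun z => \sum_(j < J) k j z + k J z.
  by apply/funext => z; rewrite big_ord_recr.
have -> : (fun z : C => \sum_(j < J.+1) dk j z) =
    fun z => \sum_(j < J) dk j z + dk J z.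
  by apply/funext => z; rewrite big_ord_recr.
exact: disc_holoD.
Qed.

Lemma normcB_le (x y : C) (a b : R) : normc x <= a -> normc y <= b ->
  normc (x - y) <= a + b.
Proof.
move=> xa yb; rewrite (le_trans (normc_triangle _ _))// normc_opp.
exact: lerD.
Qed.

Lemma normcD_le (x y : C) (a b : R) : normc x <= a -> normc y <= b ->
  normc (x + y) <= a + b.
Proof. by move=> xa yb; rewrite (le_trans (normc_triangle _ _))// lerD. Qed.

Lemma normcM_le (x y : C) (a b : R) : normc x <= a -> normc y <= b ->
  normc (x * y) <= a * b.
Proof. by move=> xa yb; rewrite normcM ler_pM ?normc_ge0. Qed.

(** The function k + l / z + m z has the pole l(0) / z at the origin and the constant
    term k(0) + l'(0).  Adding its value at -z kills the pole, so that the previous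
    mean value inequality applies to the symmetrized function. *)
Lemma laurent_mean_ge0 (s0 s : R) (k l m dk dl dm : C -> C) : 0 < s < s0 ->
  disc_holo s0 k dk -> disc_holo s0 l dl -> disc_holo s0 m dm ->
  (forall z, normc z = s -> 0 <= complex.Re (k z + l z * z^-1 + m z * z)) ->
  0 <= complex.Re (k 0 + dl 0).
Proof.
move=> /andP[sp ss0] hk hl hm pos.
pose H z := k z + k (- z) + ((l z - l (- z)) * z^-1 + (m z - m (- z)) * z).
pose dH z := dk z - dk (- z) + (((l z - l (- z)) * (- z ^- 2) + z^-1 * (dl z + dl (- z)))
   + ((m z - m (- z)) * 1 + z * (dm z + dm (- z)))).
suff : 0 <= complex.Re (k 0 + k 0 + (dl 0 + dl 0)).
  by rewrite !raddfD/=; lra.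
have oppd (f df : C -> C) z : disc_holo s0 f df -> normc z < s0 ->
    is_derive z 1 (fun z => f (- z)) (- df (- z)).
  by move=> hf zs; apply/is_derive_opp_comp/(disc_holo_derive hf); rewrite normc_opp.
have subd (f df : C -> C) z : disc_holo s0 f df -> normc z < s0 ->
    is_derive z 1 (fun z => f z - f (- z)) (df z + df (- z)).
  move=> hf zs; have := complex_is_deriveM (complex_is_derive_cst (-1) z) (oppd _ _ _ hf zs).
  rewrite mulr0 addr0 mulN1r opprK => h1.
  have := complex_is_deriveD (disc_holo_derive hf zs) h1.
  by congr is_derive; apply/funext => y; rewrite mulN1r.
have sI : 0 < s < s0 by rewrite sp.
have dHP z : 0 < normc z < s0 -> is_derive z 1 H (dH z).
  move=> /andP[z0 zs].
  have nz : z != 0 by rewrite -normc_gt0.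
  have d1 := complex_is_deriveD (disc_holo_derive hk zs) (oppd _ _ _ hk zs).
  have d2 := complex_is_deriveM (subd _ _ _ hl zs) (complex_is_deriveV nz).
  have d3 := complex_is_deriveM (subd _ _ _ hm zs) (complex_is_derive_id z).
  exact: (complex_is_deriveD d1 (complex_is_deriveD d2 d3)).
apply: (circle_mean_ge0 sI dHP).
- move=> r1 r2 r10 r2s.
  have [B1 P1] := hk _ r2s; have [B2 P2] := hl _ r2s; have [B3 P3] := hm _ r2s.
  exists (B1 + B1 + (((B2 + B2) * r1^-1 ^+ 2 + r1^-1 * (B2 + B2)) + ((B3 + B3) * 1 + r2 * (B3 + B3)))).
  move=> z /andP[r1z zr2].
  have nzr2 : normc (- z) <= r2 by rewrite normc_opp.
  have [_ k1 k2] := P1 _ zr2; have [_ l1 l2] := P2 _ zr2; have [_ m1 m2] := P3 _ zr2.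
  have [_ k1' k2'] := P1 _ nzr2; have [_ l1' l2'] := P2 _ nzr2; have [_ m1' m2'] := P3 _ nzr2.
  have zV : normc z^-1 <= r1^-1.
    by rewrite normcV lef_pV2// posrE (lt_le_trans r10).
  apply: normcD_le; first exact: normcB_le.
  apply: normcD_le; apply: normcD_le; apply: normcM_le => //.
  + exact: normcB_le.
  + rewrite normc_opp -exprVn expr2; exact: normcM_le.
  + exact: normcD_le.
  + exact: normcB_le.
  + by rewrite normc1.
  + exact: normcD_le.
- move=> e e0.
  have s00 : normc (0 : C) < s0 by rewrite normc0 (lt_trans sp).
  have e80 : 0 < e / 8 by rewrite divr_gt0.
  have dk0 := disc_holo_derive hk s00.
  have dl0 := disc_holo_derive hl s00.
  have dm0 := disc_holo_derive hm s00.
  have [r1 r10 K] := complex_is_derive_estimate ltr01 dk0.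
  have [r2 r20 L] := complex_is_derive_estimate e80 dl0.
  have [B P3] := hm _ ss0.
  pose D := normc (dk 0) + 1 + `|B|.
  have D0 : 0 < D by rewrite /D; have := normc_ge0 (dk 0); have := normr_ge0 B; lra.
  pose r := Num.min (Num.min r1 r2) (Num.min s (e / 8 / D)).
  exists r; first by rewrite !lt_min r10 r20 sp divr_gt0.
  move=> z /andP[z0]; rewrite !lt_min => /andP[/andP[zr1 zr2] /andP[zs zD]].
  have nz : z != 0 by rewrite -normc_gt0.
  rewrite ltr_pdivlMr// in zD.
  have est (y : C) : normc y = normc z -> normc (k y - k 0) <= e / 8.
    move=> yz; have := K y; rewrite yz add0r mul1r => /(_ zr1) Ky.
    have -> : k y - k 0 = (k y - k 0 - dk 0 * y) + dk 0 * y by ring.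
    rewrite (le_trans (normc_triangle _ _))// normcM yz.
    have : `|B| * normc z >= 0 by rewrite mulr_ge0 ?normc_ge0.
    move: zD; rewrite /D; lra.
  have estl (y : C) : normc y = normc z ->
      normc (l y - l 0 - dl 0 * y) <= e / 8 * normc z.
    by move=> yz; have := L y; rewrite yz add0r => /(_ zr2).
  have zz := normc_opp z.
  have -> : H z - (k 0 + k 0 + (dl 0 + dl 0)) =
      (k z - k 0) + (k (- z) - k 0) +
      ((((l z - l 0 - dl 0 * z) - (l (- z) - l 0 - dl 0 * (- z))) * z^-1)
       + (m z - m (- z)) * z).
    by rewrite /H; field.
  have M1 : normc (m z) <= B by have [] := P3 z (ltW zs).
  have nzs : normc (- z) <= s by rewrite zz ltW.
  have M2 : normc (m (- z)) <= B by have [] := P3 _ nzs.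
  apply: le_trans (normcD_le (normcD_le (est _ erefl) (est _ zz))
    (normcD_le (normcM_le (normcB_le (estl _ erefl) (estl _ zz)) (lexx _))
       (normcM_le (normcB_le M1 M2) (lexx _)))) _.
  rewrite normcV.
  have -> : (e / 8 * normc z + e / 8 * normc z) * (normc z)^-1 = e / 8 + e / 8.
    by rewrite -mulrDl mulfK// gt_eqF.
  have : B * normc z <= D * normc z.
    rewrite ler_wpM2r ?normc_ge0// /D; have := ler_norm B; have := normc_ge0 (dk 0); lra.
  move: zD; lra.
- move=> z zs; have := pos z zs; have := pos (- z).
  rewrite normc_opp => /(_ zs).
  rewrite /H invrN mulrN !mulrBl !mulrN !raddfD/= !raddfN/=.
  by lra.
Qed.

End DiscFunctions.

(** * Schwarz inequalities for maps into the unit ball *)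

Section Schwarz.
Variable R : realType.
Local Notation C := R[i].

Lemma Re_sum (J : nat) (f : 'I_J -> C) :
  complex.Re (\sum_(j < J) f j) = \sum_(j < J) complex.Re (f j).
Proof. by rewrite raddf_sum. Qed.

(** On the circle the conjugate of z is thus the restriction of a holomorphic function
    with a pole, to which [laurent_mean_ge0] applies. *)
Lemma sqr_conj_div (z : C) (s : R) : 0 < s -> normc z = s ->
  (s ^+ 2)%:C * z^-1 = z^*%C.
Proof.
move=> s0 zs; have nz : z != 0 by rewrite -normc_gt0 zs.
apply: (mulIf nz); rewrite mulfVK//.
rewrite -zs sqr_normcE; case: z {nz zs} => x y /=; apply/eqP.
by rewrite eq_complex /=; apply/andP; split; apply/eqP; ring.
Qed.

(** The right-hand side plus |f|^2 is |f - w - v z|^2. *)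
Lemma Re_polarization_ge (f w v z : C) :
  - (complex.Re f ^+ 2 + complex.Im f ^+ 2) <=
  complex.Re
    ((complex.Re w ^+ 2 + complex.Im w ^+ 2 +
      (complex.Re z ^+ 2 + complex.Im z ^+ 2) *
      (complex.Re v ^+ 2 + complex.Im v ^+ 2))%:C +
     (-2 * (w^*%C * f) + (-2 * (v^*%C * f * z^*%C) + 2 * (v * w^*%C * z)))).
Proof.
case: f w v z => f1 f2 [w1 w2] [v1 v2] [x y] /=.
rewrite -subr_ge0 opprK.
set E := (X in 0 <= X).
have -> : E = (f1 - w1 - (v1 * x - v2 * y)) ^+ 2
    + (f2 - w2 - (v1 * y + v2 * x)) ^+ 2 by rewrite /E; ring.
by rewrite addr_ge0 ?sqr_ge0.
Qed.

Variables (s0 s : R) (J : nat) (F u : C -> nat -> C).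
Hypothesis sI : 0 < s < s0.
Hypothesis hF : forall j, disc_holo s0 (F^~ j) (u^~ j).
Hypothesis F1 : forall z, normc z < s0 -> \sum_(j < J) normc (F z j) ^+ 2 <= 1.

Let w := F 0.
Let v := u 0.
Let a := \sum_(j < J) normc (w j) ^+ 2.
Let c := \sum_(j < J) normc (v j) ^+ 2.
Let beta : C := \sum_(j < J) v j * (w j)^*%C.

Lemma disc_holo_pairing (x : nat -> C) :
  disc_holo s0 (fun z => \sum_(j < J) (x j)^*%C * F z j)
               (fun z => \sum_(j < J) (x j)^*%C * u z j).
Proof.
exact: (@disc_holo_sum R s0 J (fun j z => (x j)^*%C * F z j)
  (fun j z => (x j)^*%C * u z j) (fun j => disc_holoZ _ (hF j))).
Qed.

(** This is the beginning of Parseval's identity: the mean over |z| = s of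
    |F z - w - v z|^2 is nonnegative, |F z| <= 1, and the mean of the cross terms
    is read off from the first two Taylor coefficients w and v of F. *)
Lemma schwarz_norm : c * s ^+ 2 <= 1 - a.
Proof.
have [sp ss0] := andP sI.
(* On |z| = s the real part of this Laurent sum is the real part of
   1 + |w|^2 + |v z|^2 - 2 <F z, w + v z> + 2 <v z, w>. *)
have := laurent_mean_ge0 sI
  (disc_holoD (@disc_holo_cst R s0 (1 + a + s ^+ 2 * c)%:C)
              (disc_holoZ (-2) (disc_holo_pairing w)))
  (disc_holoZ (-2 * s ^+ 2)%:C (disc_holo_pairing v))
  (@disc_holo_cst R s0 (2 * beta)).
cbv beta.
have Hw : \sum_(j < J) (w j)^*%C * F 0 j = a%:C.
  rewrite /a rmorph_sum/=; apply: eq_bigr => j _.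
  rewrite -/w sqr_normcE; case: (w j) => x y /=; apply/eqP.
  by rewrite eq_complex /=; apply/andP; split; apply/eqP; ring.
have Hv : \sum_(j < J) (v j)^*%C * u 0 j = c%:C.
  rewrite /c rmorph_sum/=; apply: eq_bigr => j _.
  rewrite -/v sqr_normcE; case: (v j) => x y /=; apply/eqP.
  by rewrite eq_complex /=; apply/andP; split; apply/eqP; ring.
rewrite Hw Hv.
have -> : complex.Re ((1 + a + s ^+ 2 * c)%:C + -2 * a%:C + (-2 * s ^+ 2)%:C * c%:C)
   = 1 - a - s ^+ 2 * c by rewrite /=; ring.
move=> H; suff : 0 <= 1 - a - s ^+ 2 * c by lra.
apply: H => z zs.
have zs0 : normc z < s0 by rewrite zs.
have -> : (-2 * s ^+ 2)%:C * (\sum_(j < J) (v j)^*%C * F z j) / z =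
    \sum_(j < J) (-2) * ((v j)^*%C * F z j * z^*%C).
  have -> : (-2 * s ^+ 2)%:C * (\sum_(j < J) (v j)^*%C * F z j) / z =
     (-2) * ((\sum_(j < J) (v j)^*%C * F z j) * ((s ^+ 2)%:C * z^-1)).
    by rewrite rmorphM rmorphN rmorph_nat /=; ring.
  by rewrite sqr_conj_div// mulr_suml mulr_sumr.
have -> : 2 * beta * z = \sum_(j < J) 2 * (v j * (w j)^*%C * z).
  by rewrite /beta -mulrA mulr_suml mulr_sumr.
have -> : (1 + a + s ^+ 2 * c)%:C = 1 + \sum_(j < J)
    (normc (w j) ^+ 2 + s ^+ 2 * normc (v j) ^+ 2)%:C.
  by rewrite -rmorph_sum big_split/= -mulr_sumr -/a -/c -addrA rmorphD rmorph1.
rewrite mulr_sumr -!addrA -!big_split/= raddfD/= Re_sum.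
have := F1 zs0; set T := \sum_(j < J) complex.Re _.
suff : - \sum_(j < J) normc (F z j) ^+ 2 <= T by lra.
rewrite -sumrN; apply: ler_sum => j _.
have z2 := sqr_normcE z; rewrite zs in z2.
rewrite !sqr_normcE z2.
exact: Re_polarization_ge.
Qed.

(** The holomorphic function p(z) = 1 - <F z, w> has nonnegative real part, because
    F z and w are in the unit ball.  Caratheodory's inequality
    s |p'(0)| <= 2 Re p(0) is then the stated one.  It follows by multiplying p by
    2 b + 2 Re (beta z) / s, which is nonnegative on |z| = s.  The linear factor
    1 - a on the right, instead of its square root, is what the second term of
    the hyperbolic metric requires near the boundary of the ball. *)
Lemma schwarz_pairing : normc beta * s <= 2 * (1 - a).
Proof.
have [sp ss0] := andP sI.
have s00 : normc (0 : C) < s0 by rewrite normc0 (lt_trans sp).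
set b := normc beta.
have [b0|b0] := leP b 0.
  have -> : b = 0 by apply/eqP; rewrite eq_le b0 normc_ge0.
  by rewrite mul0r mulr_ge0// subr_ge0; exact: F1.
pose p z := 1 + (-1) * \sum_(j < J) (w j)^*%C * F z j.
pose dp z := 0 + (-1) * \sum_(j < J) (w j)^*%C * u z j.
have hp : disc_holo s0 p dp.
  exact: (disc_holoD (@disc_holo_cst R s0 1) (disc_holoZ (-1) (disc_holo_pairing w))).
(* On |z| = s the three terms add up to (2 b + 2 Re (beta z) / s) p(z). *)
have := laurent_mean_ge0 sI (disc_holoZ (2 * b)%:C hp)
  (disc_holoZ (beta^*%C * s%:C) hp) (disc_holoZ (beta * s^-1%:C) hp).
cbv beta.
have p0 : p 0 = (1 - a)%:C.
  rewrite /p mulN1r rmorphB rmorph1 /=; congr (_ - _).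
  rewrite /a rmorph_sum/=; apply: eq_bigr => j _.
  rewrite -/w sqr_normcE; case: (w j) => x y /=; apply/eqP.
  by rewrite eq_complex /=; apply/andP; split; apply/eqP; ring.
have dp0 : dp 0 = - beta.
  rewrite /dp add0r mulN1r; congr (- _).
  by apply: eq_bigr => j _; rewrite mulrC.
rewrite p0 dp0.
have -> : complex.Re ((2 * b)%:C * (1 - a)%:C + beta^*%C * s%:C * - beta)
   = b * (2 * (1 - a) - b * s).
  have -> : beta^*%C * s%:C * - beta = (- s * b ^+ 2)%:C.
    rewrite /b sqr_normcE; case: beta => x y /=; apply/eqP.
    by rewrite eq_complex /=; apply/andP; split; apply/eqP; ring.
  by rewrite /=; ring.
rewrite pmulr_rge0// subr_ge0; apply => z zs.
have zs0 : normc z < s0 by rewrite zs.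
have -> : (2 * b)%:C * p z + beta^*%C * s%:C * p z / z + beta * s^-1%:C * p z * z =
   (2 * b + 2 * complex.Re (beta * z) / s)%:C * p z.
  have sC : s%:C != 0 :> C by rewrite -normc_eq0E normc_real normr_eq0 gt_eqF.
  have zV : s%:C * z^-1 = s^-1%:C * z^*%C.
    rewrite -(sqr_conj_div sp zs) rmorphXn/= fmorphV; field; rewrite sC -normc_gt0 zs sp//.
  have -> : beta^*%C * s%:C * p z / z = beta^*%C * (s%:C * z^-1) * p z by ring.
  rewrite zV.
  have -> : beta * s^-1%:C * p z * z = beta * (s^-1%:C * z) * p z by ring.
  rewrite -!mulrDl; congr (_ * _).
  case: beta z {zs zs0 zV} => b1 b2 [x y] /=; apply/eqP.
  by rewrite eq_complex /=; apply/andP; split; apply/eqP; ring.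
have q0 : 0 <= 2 * b + 2 * complex.Re (beta * z) / s.
  have : - (b * s) <= complex.Re (beta * z).
    by rewrite lerNl (le_trans (ler_norm _))// normrN (le_trans (normc_Re_le _))// normcM zs.
  rewrite -mulNr -ler_pdivlMr// -mulrA; lra.
have -> : complex.Re ((2 * b + 2 * complex.Re (beta * z) / s)%:C * p z) =
    (2 * b + 2 * complex.Re (beta * z) / s) * complex.Re (p z).
  by case: (p z) => x y /=; rewrite mul0r subr0.
rewrite mulr_ge0// /p raddfD/= mulN1r raddfN/= subr_ge0 Re_sum.
have Fz := F1 zs0; have F0 := F1 s00.
suff : \sum_(j < J) complex.Re ((w j)^*%C * F z j) <=
    2^-1 * (\sum_(j < J) normc (w j) ^+ 2 + \sum_(j < J) normc (F z j) ^+ 2) by rewrite /w; lra.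
rewrite -big_split/= mulr_sumr; apply: ler_sum => j _.
rewrite !sqr_normcE; case: (F z j) (w j) => f1 f2 [w1 w2] /=.
have := sqr_ge0 (f1 - w1); have := sqr_ge0 (f2 - w2); nra.
Qed.

End Schwarz.

(** * The hyperbolic metric in coordinates *)

Section HyperbolicMetric.
Variable R : realType.
Local Notation C := R[i].
Local Notation S := (nat -> R[i]).
Implicit Types w u v : S.

Definition partial_sqnorm (J : nat) w : R := \sum_(j < J) normc (w j) ^+ 2.

Definition partial_pairing (J : nat) u w : C := \sum_(j < J) u j * (w j)^*%C.

Lemma sqnorm_lim w (l : R) :
  sqnorm w = l%:E <-> partial_sqnorm^~ w @ \oo --> l.
Proof.
have E : (fun J => (partial_sqnorm J w)%:E) =
    (fun J => \sum_(0 <= j < J) (complex.Re (w j) ^+ 2 + complex.Im (w j) ^+ 2)%:E)%E.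
  apply/funext => J; rewrite sumEFin big_mkord; congr EFin.
  by apply: eq_bigr => j _; rewrite sqr_normcE.
have cE : (fun J => (partial_sqnorm J w)%:E) @ \oo --> sqnorm w.
  rewrite E; apply: is_cvg_nneseries => j _ _.
  by rewrite lee_fin addr_ge0 ?sqr_ge0.
split=> [sw|Sl].
  by rewrite sw in cE; exact: (fine_cvg cE).
have cl : (fun J => (partial_sqnorm J w)%:E) @ \oo --> l%:E.
  by apply: cvg_EFin => //; exact: nearW.
by rewrite -(cvg_lim _ cE)// -(cvg_lim _ cl).
Qed.

Lemma sqnorm_cvg w : (sqnorm w < +oo)%E ->
  partial_sqnorm^~ w @ \oo --> fine (sqnorm w).
Proof.
move=> wfin; apply/sqnorm_lim; rewrite fineK// ge0_fin_numE//.
by apply: nneseries_ge0 => j _ _; rewrite lee_fin addr_ge0 ?sqr_ge0.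
Qed.

Lemma partial_sqnorm_ge0 J w : 0 <= partial_sqnorm J w.
Proof. by apply: sumr_ge0 => j _; exact: sqr_ge0. Qed.

Lemma partial_sqnorm_nd w : nondecreasing_seq (partial_sqnorm^~ w).
Proof.
apply/nondecreasing_seqP => J.
by rewrite /partial_sqnorm big_ord_recr/= lerDl sqr_ge0.
Qed.

Lemma partial_sqnorm_le J w : (sqnorm w < +oo)%E -> partial_sqnorm J w <= fine (sqnorm w).
Proof.
move=> wfin; have cw := sqnorm_cvg wfin.
rewrite -(cvg_lim _ cw)//; apply: nondecreasing_cvgn_le; first exact: partial_sqnorm_nd.
by apply/cvg_ex; exists (fine (sqnorm w)).
Qed.

Lemma sqr_normc_le_sqnorm w j : (sqnorm w < +oo)%E ->
  normc (w j) ^+ 2 <= fine (sqnorm w).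
Proof.
move=> wfin; apply: le_trans (partial_sqnorm_le j.+1 wfin).
by rewrite /partial_sqnorm big_ord_recr/= lerDr; exact: partial_sqnorm_ge0.
Qed.

Lemma partial_sqnorm_line J w v (t : R) :
  partial_sqnorm J (w + t%:C *: v) =
  partial_sqnorm J w + 2 * t * complex.Re (partial_pairing J v w) + t ^+ 2 * partial_sqnorm J v.
Proof.
rewrite /partial_sqnorm /partial_pairing raddf_sum/= !mulr_sumr -!big_split/=.
apply: eq_bigr => j _; rewrite !sqr_normcE !fctE.
by case: (w j) (v j) => w1 w2 [v1 v2] /=; ring.
Qed.

(** By polarization, the partial pairings are combinations of partial norms, which
    are monotone and bounded. *)
Lemma pairing_Re_cvg w v : (sqnorm w < +oo)%E -> (sqnorm v < +oo)%E ->
  exists b : R, (fun J => complex.Re (partial_pairing J v w)) @ \oo --> b.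
Proof.
move=> wfin vfin; have cw := sqnorm_cvg wfin; have cv := sqnorm_cvg vfin.
have E : (fun J => complex.Re (partial_pairing J v w)) =
    (fun J => 2^-1 * (partial_sqnorm J (w + 1%:C *: v) - partial_sqnorm J w - partial_sqnorm J v)).
  by apply/funext => J; rewrite partial_sqnorm_line; field.
have : cvgn (partial_sqnorm^~ (w + 1%:C *: v)).
  apply: nondecreasing_is_cvgn; first exact: partial_sqnorm_nd.
  exists (2 * (fine (sqnorm w) + fine (sqnorm v))) => _ [J _ <-].
  have wJ : partial_sqnorm J w <= fine (sqnorm w) by exact: partial_sqnorm_le.
  have vJ : partial_sqnorm J v <= fine (sqnorm v) by exact: partial_sqnorm_le.
  have := partial_sqnorm_ge0 J (w + (-1)%:C *: v).
  rewrite !partial_sqnorm_line; lra.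
move=> /cvg_ex[l cl]; exists (2^-1 * (l - fine (sqnorm w) - fine (sqnorm v))).
rewrite E; apply: cvgM; first exact: cvg_cst.
by apply: cvgB => //; exact: cvgB.
Qed.

Lemma partial_pairing_i J w v :
  complex.Re (partial_pairing J ('i%C *: v) w) = - complex.Im (partial_pairing J v w).
Proof.
rewrite /partial_pairing [LHS]raddf_sum [complex.Im _]raddf_sum -sumrN.
apply: eq_bigr => j _; rewrite !fctE.
by case: (w j) (v j) => w1 w2 [v1 v2] /=; ring.
Qed.

Lemma partial_sqnorm_i J v : partial_sqnorm J ('i%C *: v) = partial_sqnorm J v.
Proof.
rewrite /partial_sqnorm; apply: eq_bigr => j _; rewrite !sqr_normcE !fctE.
by case: (v j) => v1 v2 /=; ring.
Qed.

(** On a real line the norm squared is a quadratic polynomial of the parameter. *)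
Lemma hyp_potential_line w v (b : R) (t : R) :
  (sqnorm w < +oo)%E -> (sqnorm v < +oo)%E ->
  (fun J => complex.Re (partial_pairing J v w)) @ \oo --> b ->
  hyp_potential (w + t%:C *: v) =
  - ln (1 - (fine (sqnorm w) + 2 * t * b + t ^+ 2 * fine (sqnorm v))).
Proof.
move=> /sqnorm_cvg cw /sqnorm_cvg cv cb; rewrite /hyp_potential.
suff /sqnorm_lim -> : partial_sqnorm^~ (w + t%:C *: v) @ \oo -->
    fine (sqnorm w) + 2 * t * b + t ^+ 2 * fine (sqnorm v) by [].
under eq_fun do rewrite partial_sqnorm_line.
apply: cvgD; last by apply: cvgM => //; exact: cvg_cst.
by apply: cvgD => //; apply: cvgM => //; exact: cvg_cst.
Qed.

Lemma is_derive_quad (a b c t : R) :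
  let q t : R := 1 - (a + 2 * t * b + t ^+ 2 * c) in is_derive t 1 q (- (2 * b + 2 * t * c)).
Proof.
move=> q; have -> : q = (cst (1 - a) : R -> R) - ((2 * b) *: (id : R -> R)) - (c *: ((id : R -> R) ^+ 2)).
  by apply/funext => x; rewrite /q !fctE /= -[_ *: _]/(_ * _) -[_ *: _]/(_ * _); ring.
apply: is_derive_eq.
by rewrite -![_ *: _]/(_ * _) /=; ring.
Qed.

Section LogQuadratic.
Variables (a b c : R).
Let q (t : R) : R := 1 - (a + 2 * t * b + t ^+ 2 * c).

Lemma is_derive_logquad (t : R) : 0 < q t ->
  is_derive t 1 (fun t => - ln (q t)) ((2 * b + 2 * t * c) / q t).
Proof.
move=> q0; have dq : is_derive t 1 q _ := is_derive_quad a b c t.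
have dl := is_derive1_ln q0.
have := @is_deriveN _ _ _ _ _ _ _ (@is_derive1_comp R (@ln R) q t _ _ dl dq).
by rewrite mulrN opprK mulrC.
Qed.

Lemma is_derive_logquad2 : 0 < q 0 ->
  is_derive (0:R) 1 (fun t => (2 * b + 2 * t * c) / q t)
    (2 * c / q 0 + (2 * b) ^+ 2 / q 0 ^+ 2).
Proof.
move=> q0; have dq : is_derive (0:R) 1 q _ := is_derive_quad a b c 0.
have dV := @is_deriveV R q 0 _ 1 (lt0r_neq0 q0) dq.
have dn : is_derive (0:R) 1 (fun t => 2 * b + 2 * t * c) (2 * c).
  have := @is_derive_quad (1 - 2 * b) (- c) 0 0.
  by congr is_derive; [apply/funext => t; ring|ring].
have := @is_deriveM R R _ _ 0 1 _ _ dn dV.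
congr is_derive; rewrite -![_ *: _]/(_ * _) /=; field.
exact: lt0r_neq0.
Qed.

End LogQuadratic.

Lemma ddirE (V : lmodType R[i]) (f : V -> R) (x v : V) :
  ddir f x v = derive1 (fun t => f (x + t%:C *: v)) 0.
Proof. by rewrite ddir.unlock. Qed.

Lemma ddir_comp_line (V : lmodType R[i]) (f : V -> R) (x v : V) (t : R) :
  ddir f (x + t%:C *: v) v = derive1 (fun s => f (x + (t + s)%:C *: v)) 0.
Proof.
rewrite ddirE; congr (derive1 _ 0); apply/funext => s.
by rewrite rmorphD/= scalerDl addrA.
Qed.

Lemma hyp_potential_hessian w v (b : R) :
  (sqnorm w < 1)%E -> (sqnorm v < +oo)%E ->
  (fun J => complex.Re (partial_pairing J v w)) @ \oo --> b ->
  ddir (fun y => ddir (@hyp_potential R) y v) w v =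
    2 * fine (sqnorm v) / (1 - fine (sqnorm w))
    + (2 * b) ^+ 2 / (1 - fine (sqnorm w)) ^+ 2.
Proof.
move=> w1 vfin cb.
have wfin : (sqnorm w < +oo)%E by rewrite (lt_trans w1) ?ltry.
set a := fine (sqnorm w); set c := fine (sqnorm v).
have a1 : a < 1 by rewrite /a -lte_fin fineK// ge0_fin_numE// nneseries_ge0// => j _ _; rewrite lee_fin addr_ge0 ?sqr_ge0.
pose q (t : R) : R := 1 - (a + 2 * t * b + t ^+ 2 * c).
have q0 : 0 < q 0 by rewrite /q; lra.
have qE : q 0 = 1 - a by rewrite /q; ring.
rewrite -qE.
have near_q : \forall t \near (0 : R), 0 < q t.
  have := is_derive_continuous (is_derive_quad a b c 0) => cq.
  exact: (@cvgr_gt _ _ _ _ q (q 0) cq 0 q0).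
have lineE (t : R) : hyp_potential (w + t%:C *: v) = - ln (q t).
  exact: hyp_potential_line.
have inner : \forall t \near (0 : R),
    (2 * b + 2 * t * c) / q t = ddir (@hyp_potential R) (w + t%:C *: v) v.
  apply: filterS near_q => t qt.
  rewrite ddir_comp_line.
  have -> : (fun s => hyp_potential (w + (t + s)%:C *: v)) = (fun s => - ln (q s)) \o shift t.
    by apply/funext => s; rewrite lineE /= addrC.
  have dt : is_derive (shift t 0) 1 (fun s => - ln (q s)) ((2 * b + 2 * t * c) / q t).
    by rewrite /= add0r; exact: is_derive_logquad.
  have := @is_derive1_comp R _ (shift t) 0 _ _ dt (is_derive_shift 0 1 t).
  by rewrite mulr1 derive1E => d; rewrite derive_val.
have d2 := near_eq_is_derive inner (is_derive_logquad2 q0).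
by rewrite ddirE derive1E derive_val.
Qed.

(** The Bergman form of the metric: |v|^2 / (1 - |w|^2) +
    |<v, w>|^2 / (1 - |w|^2)^2, where <v, w> is given by the limits b and b' of the
    real and imaginary parts of its partial sums. *)
Lemma hyp_metricE w v :
  (sqnorm w < 1)%E -> (sqnorm v < +oo)%E ->
  exists b b' : R,
  [/\ (fun J => complex.Re (partial_pairing J v w)) @ \oo --> b,
      (fun J => complex.Im (partial_pairing J v w)) @ \oo --> b' &
  hyp_metric w v v = fine (sqnorm v) / (1 - fine (sqnorm w))
    + (b ^+ 2 + b' ^+ 2) / (1 - fine (sqnorm w)) ^+ 2].
Proof.
move=> w1 vfin.
have wfin : (sqnorm w < +oo)%E by rewrite (lt_trans w1) ?ltry.
(* The metric averages the Hessian of the potential over v and i v, which makes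
   the imaginary part of the pairing appear. *)
have iv : sqnorm ('i%C *: v) = (fine (sqnorm v))%:E.
  apply/sqnorm_lim; under eq_fun do rewrite partial_sqnorm_i.
  exact: sqnorm_cvg.
have ivfin : (sqnorm ('i%C *: v) < +oo)%E by rewrite iv ltry.
have [b cb] := pairing_Re_cvg wfin vfin.
have [b' cb'] := pairing_Re_cvg wfin ivfin.
exists b, (- b'); split=> //.
  have -> : (fun J => complex.Im (partial_pairing J v w)) =
      - (fun J => complex.Re (partial_pairing J ('i%C *: v) w)).
    by apply/funext => J; rewrite !fctE partial_pairing_i opprK.
  exact: cvgN.
rewrite /hyp_metric /levi (hyp_potential_hessian w1 vfin cb).
rewrite (hyp_potential_hessian w1 ivfin cb') iv /=.
have : 0 < 1 - fine (sqnorm w).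
  rewrite subr_gt0 -lte_fin fineK// ge0_fin_numE// nneseries_ge0// => j _ _.
  by rewrite lee_fin addr_ge0 ?sqr_ge0.
by move=> /lt0r_neq0 h; field.
Qed.

End HyperbolicMetric.

(** * The Schwarz lemma for the hyperbolic metric *)

Section HyperbolicSchwarz.
Variable R : realType.
Local Notation C := R[i].

Lemma sqnorm_ge0 (w : nat -> R[i]) : (0 <= sqnorm w)%E.
Proof. by apply: nneseries_ge0 => j _ _; rewrite lee_fin addr_ge0 ?sqr_ge0. Qed.

Lemma fine_sqnorm_lt1 (w : nat -> R[i]) : (sqnorm w < 1)%E -> fine (sqnorm w) < 1.
Proof.
move=> w1; rewrite -lte_fin fineK// ge0_fin_numE ?sqnorm_ge0//.
by rewrite (lt_trans w1) ?ltry.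
Qed.

(** The two terms of the metric are at most 1 / s^2 by [schwarz_norm] and 4 / s^2 by
    [schwarz_pairing], after a passage to the limit from finitely many
    coordinates. *)
Lemma hyp_metric_schwarz (s0 s : R) (F u : C -> nat -> C) : 0 < s < s0 ->
  (forall j, disc_holo s0 (F^~ j) (u^~ j)) ->
  (forall z, normc z < s0 -> (sqnorm (F z) < 1)%E) ->
  (sqnorm (u 0%R) < +oo)%E ->
  hyp_metric (F 0) (u 0) (u 0) <= 5 / s ^+ 2.
Proof.
move=> /[dup] sI /andP[sp ss0] hF F1 ufin.
have s00 : normc (0 : C) < s0 by rewrite normc0 (lt_trans sp).
have wfin z : normc z < s0 -> (sqnorm (F z) < +oo)%E.
  by move=> /F1 h; rewrite (lt_trans h) ?ltry.
have F1' J z : normc z < s0 -> partial_sqnorm J (F z) <= 1.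
  move=> zs; rewrite (le_trans (partial_sqnorm_le J (wfin _ zs)))//.
  by rewrite ltW// fine_sqnorm_lt1// F1.
have [b [b' [cb cb' ->]]] := hyp_metricE (F1 _ s00) ufin.
have cw := sqnorm_cvg (wfin _ s00); have cu := sqnorm_cvg ufin.
set a := fine (sqnorm (F 0)) in cw *; set c := fine (sqnorm (u 0)) in cu *.
have a1 : 0 < 1 - a by rewrite subr_gt0 fine_sqnorm_lt1// F1.
have c1 : c * s ^+ 2 <= 1 - a.
  have l1 : (fun J => partial_sqnorm J (u 0) * s ^+ 2) @ \oo --> c * s ^+ 2.
    by apply: cvgM => //; exact: cvg_cst.
  have l2 : (fun J => 1 - partial_sqnorm J (F 0)) @ \oo --> 1 - a.
    by apply: cvgB => //; exact: cvg_cst.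
  apply: (ler_cvg_to l1 l2); apply: nearW => J.
  exact: (schwarz_norm sI hF (F1' J)).
have b1 : (b ^+ 2 + b' ^+ 2) * s ^+ 2 <= 4 * (1 - a) ^+ 2.
  have l1 : (fun J => (complex.Re (partial_pairing J (u 0) (F 0)) ^+ 2
        + complex.Im (partial_pairing J (u 0) (F 0)) ^+ 2) * s ^+ 2) @ \oo
      --> (b ^+ 2 + b' ^+ 2) * s ^+ 2.
    apply: cvgM; last exact: cvg_cst.
    by apply: cvgD; apply: cvgM.
  have l2 : (fun J => 4 * (1 - partial_sqnorm J (F 0)) ^+ 2) @ \oo --> 4 * (1 - a) ^+ 2.
    apply: cvgM; first exact: cvg_cst.
    by apply: cvgM; apply: cvgB => //; exact: cvg_cst.
  apply: (ler_cvg_to l1 l2); apply: nearW => J.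
  have := schwarz_pairing sI hF (F1' J).
  rewrite -sqr_normcE -/(partial_pairing J (u 0) (F 0)) -/(partial_sqnorm J (F 0)).
  have := normc_ge0 (partial_pairing J (u 0) (F 0)); move: (normc _) => N.
  move=> N0 h; have : 0 <= N * s by rewrite mulr_ge0// ltW.
  by move: h; nra.
rewrite ler_pdivlMr ?exprn_gt0// mulrDl.
have h1 : c / (1 - a) * s ^+ 2 <= 1.
  by rewrite mulrAC ler_pdivrMr// mul1r.
have h2 : (b ^+ 2 + b' ^+ 2) / (1 - a) ^+ 2 * s ^+ 2 <= 4.
  by rewrite mulrAC ler_pdivrMr ?exprn_gt0.
by rewrite (le_trans (lerD h1 h2))//; lra.
Qed.

Lemma sqr_normc_le_hyp_metric (w v : nat -> C) j :
  (sqnorm w < 1)%E -> (sqnorm v < +oo)%E ->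
  normc (v j) ^+ 2 <= hyp_metric w v v.
Proof.
move=> w1 vfin; have [b [b' [_ _ ->]]] := hyp_metricE w1 vfin.
have a1 := fine_sqnorm_lt1 w1.
have a0 : 0 <= fine (sqnorm w) by rewrite fine_ge0 ?sqnorm_ge0.
have vj := sqr_normc_le_sqnorm j vfin.
have h : fine (sqnorm v) <= fine (sqnorm v) / (1 - fine (sqnorm w)).
  rewrite ler_pdivlMr ?subr_gt0// ler_piMr ?lerBlDr ?lerDl//.
  by rewrite fine_ge0 ?sqnorm_ge0.
rewrite (le_trans vj)// (le_trans h)// lerDl divr_ge0 ?sqr_ge0//.
by rewrite addr_ge0 ?sqr_ge0.
Qed.

End HyperbolicSchwarz.

(** * A minimum principle for the Laplacian *)

Section MinimumPrinciple.
Variable R : realType.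
Local Notation C := R[i].

(** Otherwise f' would be negative just to the right of its zero 0, and f would
    decrease there. *)
Lemma second_derivative_ge0 (f f' : R -> R) (d e : R) : 0 < e ->
  (forall t : R, `|t| < e -> is_derive t 1 f (f' t)) ->
  is_derive (0 : R) 1 f' d ->
  (forall t : R, `|t| < e -> f 0 <= f t) -> 0 <= d.
Proof.
move=> e0 df df' fmin; rewrite leNgt; apply/negP => d0.
have f'0 : f' 0 = 0.
  have df0 : is_derive (0 : R) 1 f 0.
    apply: (@derive1_at_min R f (- e) e 0).
    - lra.
    - move=> t; rewrite in_itv /= -ltr_norml => te.
      by have dt := df t te; exact: ex_derive.
    - by rewrite in_itv /= oppr_lt0 e0.
    - by move=> t; rewrite in_itv /= -ltr_norml => te; exact: fmin.
  have e0' : `|0 : R| < e by rewrite normr0.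
  rewrite -(@derive_val _ _ _ _ _ _ _ (df _ e0')).
  exact: (@derive_val _ _ _ _ _ _ _ df0).
have d20 : 0 < - d / 2 by lra.
have /is_derive_estimateP/(_ _ d20)/nbhs_normP[r /= r0 rP] := df'.
pose t := Num.min (r / 2) (e / 2).
have t0 : 0 < t by rewrite lt_min !divr_gt0.
have tr : t < r by rewrite (@le_lt_trans _ _ (r / 2)) ?ge_min ?lexx//; lra.
have te : t < e by rewrite (@le_lt_trans _ _ (e / 2)) ?ge_min ?lexx ?orbT//; lra.
have [||x] := @MVT R f f' 0 t t0.
- move=> x; rewrite in_itv /= => /andP[x0 xt]; apply: df.
  by rewrite gtr0_norm// (lt_trans xt).
- apply: derivable_within_continuous => x; rewrite in_itv /= => /andP[x0 xt].
  have xe : `|x| < e by rewrite ger0_norm// (le_lt_trans xt).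
  by have dx := df x xe; exact: ex_derive.
rewrite in_itv /= => /andP[x0 xt] E.
have f't : f' x < 0.
  have : ball_ (@Num.norm _ _) 0 r x.
    by rewrite /ball_ /= sub0r normrN gtr0_norm// (lt_trans xt).
  move/rP; rewrite /= add0r f'0 subr0 (gtr0_norm x0) -[_ *: _]/(x * d).
  have := ler_norm (f' x - x * d).
  have : x * d < 0 by rewrite pmulr_rlt0.
  lra.
have : f' x * (t - 0) < 0 by rewrite subr0 nmulr_rlt0.
have := fmin t; rewrite gtr0_norm// => /(_ te); lra.
Qed.

(** Real coordinates on the complex line: compactness of discs is obtained from
    that of products of real segments. *)
Definition plane (p : R * R) : C := p.1 +i* p.2.

Lemma plane_continuous : continuous plane.
Proof.
move=> p; apply/cvgrPdist_le => e e0.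
have eE : e = (complex.Re e)%:C by rewrite RRe_real// gtr0_real.
have e0' : 0 < complex.Re e / 2 by rewrite divr_gt0// -ltcR -eE.
have c1 : fst q @[q --> p] --> fst p by exact: cvg_fst.
have c2 : snd q @[q --> p] --> snd p by exact: cvg_snd.
move/cvgrPdist_le : c1 => /(_ _ e0').
move/cvgrPdist_le : c2 => /(_ _ e0').
apply: filterS2 => q q2 q1; rewrite eE normcR lecR.
rewrite (le_trans (normc_le_ReIm _))// (splitr (complex.Re e)).
by rewrite lerD.
Qed.

Definition closed_disc (z0 : C) (r : R) : set (R * R) :=
  [set p | normc (plane p - z0) <= r].

Lemma normc_continuous (z0 : C) : continuous (fun p => normc (plane p - z0)).
Proof.
move=> p; apply/cvgrPdist_le => e e0.
have eC : 0 < e%:C by rewrite ltcR.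
have /cvgrPdist_le/(_ _ eC) := @plane_continuous p.
apply: filterS => q; rewrite normcR lecR; apply: le_trans.
rewrite ler_norml; apply/andP; split.
  rewrite lerNl opprB lerBlDr.
  have -> : plane q - z0 = - (plane p - plane q) + (plane p - z0) by ring.
  by rewrite (le_trans (normc_triangle _ _))// normc_opp.
rewrite lerBlDr.
have -> : plane p - z0 = (plane p - plane q) + (plane q - z0) by ring.
exact: normc_triangle.
Qed.

Lemma closed_disc_compact z0 r : compact (closed_disc z0 r).
Proof.
have cK : compact (`[complex.Re z0 - r, complex.Re z0 + r]%classic `*`
                   `[complex.Im z0 - r, complex.Im z0 + r]%classic : set (R * R)).
  by apply: compact_setX; exact: segment_compact.
apply: (subclosed_compact _ cK).
  have -> : closed_disc z0 r = (fun p => normc (plane p - z0)) @^-1` [set x | x <= r].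
    by [].
  apply: closed_comp; first by move=> p _; exact: normc_continuous.
  exact: closed_le.
move=> [x y] /= h; rewrite !in_itv /=.
have := le_trans (normc_Re_le _) h; have := le_trans (normc_Im_le _) h.
rewrite !ler_norml /plane; case: z0 {h cK} => x0 y0 /=; lra.
Qed.

Definition horizontal (z : C) (t : R) : C := z + t%:C.
Definition vertical (z : C) (t : R) : C := z + t *i.

Lemma horizontal_ReIm (z : C) (t : R) :
  horizontal z t = (complex.Re z + t) +i* complex.Im z.
Proof. by case: z => x y; apply/eqP; rewrite eq_complex /= addr0 !eqxx. Qed.

Lemma vertical_ReIm (z : C) (t : R) :
  vertical z t = complex.Re z +i* (complex.Im z + t).
Proof. by case: z => x y; apply/eqP; rewrite eq_complex /= addr0 !eqxx. Qed.

Lemma Re_horizontal (z : C) (t : R) :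
  complex.Re (horizontal z t) = complex.Re z + t.
Proof. by rewrite horizontal_ReIm. Qed.

Lemma Im_horizontal (z : C) (t : R) :
  complex.Im (horizontal z t) = complex.Im z.
Proof. by rewrite horizontal_ReIm. Qed.

Lemma Re_vertical (z : C) (t : R) :
  complex.Re (vertical z t) = complex.Re z.
Proof. by rewrite vertical_ReIm. Qed.

Lemma Im_vertical (z : C) (t : R) :
  complex.Im (vertical z t) = complex.Im z + t.
Proof. by rewrite vertical_ReIm. Qed.

Lemma horizontalB (z z0 : C) (t : R) :
  horizontal z t - z0 = horizontal (z - z0) t.
Proof. by rewrite /horizontal addrAC. Qed.

Lemma verticalB (z z0 : C) (t : R) : vertical z t - z0 = vertical (z - z0) t.
Proof. by rewrite /vertical addrAC. Qed.

Lemma horizontalD (z : C) (t x : R) :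
  horizontal z (t + x) = horizontal (horizontal z t) x.
Proof. by rewrite !horizontal_ReIm /= addrA. Qed.

Lemma verticalD (z : C) (t x : R) :
  vertical z (t + x) = vertical (vertical z t) x.
Proof. by rewrite !vertical_ReIm /= addrA. Qed.

Lemma is_derive_shift0 (f : R -> R) (t d : R) :
  is_derive (0:R) 1 (fun x => f (t + x)) d -> is_derive t 1 f d.
Proof.
move=> dd; apply/is_derive_estimateP => x x0.
have /is_derive_estimateP/(_ _ x0) := dd; apply: filterS => y.
by rewrite add0r addr0.
Qed.

Lemma is_derive_quad_diff (k a0 a1 b0 b1 t : R) : is_derive t 1
   (fun t => k - 2^-1 * ((a0 + t) ^+ 2 + b0) + 4^-1 * ((a1 + t) ^+ 2 + b1))
   (- (a0 + t) + 2^-1 * (a1 + t)).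
Proof.
have := @is_derive_quad R (1 - k + 2^-1 * (a0 ^+ 2 + b0) - 4^-1 * (a1 ^+ 2 + b1))
  (2^-1 * a0 - 4^-1 * a1) (4^-1) t.
by cbv zeta; congr is_derive; [apply/funext => x; field|field].
Qed.

Lemma is_derive_lin_diff (a0 a1 : R) :
  is_derive (0:R) 1 (fun t : R => - (a0 + t) + 2^-1 * (a1 + t)) (- 2^-1).
Proof.
have := @is_derive_quad R (1 + a0 - 2^-1 * a1) (4^-1) 0 0.
by cbv zeta; congr is_derive; [apply/funext => x; field|field].
Qed.

Variables (rr : R) (phi phix phiy phixx phiyy : C -> R).
Hypothesis rr0 : 0 <= rr.
Hypothesis phi_continuous : forall p, rr < normc (plane p) ->
  {for p, continuous (phi \o plane)}.
Hypothesis phi_x : forall z, rr < normc z ->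
  is_derive (0 : R) 1 (fun t => phi (horizontal z t)) (phix z).
Hypothesis phi_y : forall z, rr < normc z ->
  is_derive (0 : R) 1 (fun t => phi (vertical z t)) (phiy z).
Hypothesis phi_xx : forall z, rr < normc z ->
  is_derive (0 : R) 1 (fun t => phix (horizontal z t)) (phixx z).
Hypothesis phi_yy : forall z, rr < normc z ->
  is_derive (0 : R) 1 (fun t => phiy (vertical z t)) (phiyy z).

(** The comparison function phi - |z|^2 / 2 + |z - z0|^2 / 4 has Laplacian less than
    1 - 2 + 1 = 0, so that it has no interior minimum on the disc.  Its value at
    the center is at most K, and on the boundary it is at least s^2 / 4 - K. *)
Lemma laplacian_min_principle (z0 : C) (s K : R) : 0 < s -> s < normc z0 - rr ->
  (forall z, normc (z - z0) <= s -> `|phi z - 2^-1 * normc z ^+ 2| <= K) ->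
  (forall z, normc (z - z0) <= s -> phixx z + phiyy z < 1) ->
  s ^+ 2 <= 8 * K.
Proof.
move=> s0 sz K_ub lap.
have far z : normc (z - z0) <= s -> rr < normc z.
  move=> zs; have := normc_triangle z (- (z - z0)); rewrite normc_opp.
  have -> : z + - (z - z0) = z0 by ring.
  lra.
pose H z := phi z - 2^-1 * normc z ^+ 2 + 4^-1 * normc (z - z0) ^+ 2.
have cH : {within closed_disc z0 s, continuous (H \o plane)}.
  apply: continuous_in_subspaceT => p; rewrite inE => ps.
  have c0 : {for p, continuous (fun p => normc (plane p))}.
    have -> : (fun p => normc (plane p)) = (fun p => normc (plane p - 0)).
      by apply/funext => q; rewrite subr0.
    exact: normc_continuous.
  rewrite /continuous_at /H /=; apply: cvgD; first apply: cvgB.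
  - exact/phi_continuous/far.
  - by apply: cvgM; [exact: cvg_cst|exact: cvgM].
  - apply: cvgM; first exact: cvg_cst.
    by apply: cvgM; exact: normc_continuous.
have ne : closed_disc z0 s !=set0.
  exists (complex.Re z0, complex.Im z0); rewrite /closed_disc /=.
  have -> : plane (complex.Re z0, complex.Im z0) - z0 = 0.
    by case: z0 {sz K_ub lap far H cH} => x y; rewrite /plane /= subrr.
  by rewrite normc0 ltW.
have [p] := compact_EVT_min ne (@closed_disc_compact z0 s) cH.
rewrite inE => ps pmin.
have {}ps : normc (plane p - z0) <= s by [].
set z := plane p in ps *.
have zmin (y : C) : normc (y - z0) <= s -> H z <= H y.
  move=> ys; have := pmin (complex.Re y, complex.Im y).
  rewrite inE /closed_disc /= /plane /=; case: y ys => y1 y2 /= ys; exact.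
clearbody z; clear p pmin.
have Hz0 : H z0 <= K.
  rewrite /H subrr normc0 expr0n /= mulr0 addr0.
  have := K_ub z0; rewrite subrr normc0 => /(_ (ltW s0)).
  exact: le_trans (ler_norm _).
have HzK : - K + 4^-1 * normc (z - z0) ^+ 2 <= H z.
  have := K_ub _ ps; rewrite ler_norml => /andP[h _].
  by rewrite /H lerD2r.
have : H z <= H z0 by apply: zmin; rewrite subrr normc0 ltW.
have [zs|zs] := ltP (normc (z - z0)) s; last first.
  have zsE : normc (z - z0) = s by apply/eqP; rewrite eq_le ps.
  by rewrite zsE in HzK; lra.
exfalso.
pose e := s - normc (z - z0).
have e0 : 0 < e by rewrite subr_gt0.
have nearz (h : C) : normc h < e -> normc (z + h - z0) <= s.
  move=> he; have -> : z + h - z0 = (z - z0) + h by ring.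
  by rewrite (le_trans (normc_triangle _ _))//; move: he; rewrite /e; lra.
have hxE (t : R) : normc (t%:C) = `|t| by exact: normc_real.
have hyE (t : R) : normc (t *i : C) = `|t| by rewrite /normc /= expr0n /= add0r sqrtr_sqr.
have zfar : rr < normc z := far z ps.
have dxx : 0 <= phixx z - 2^-1.
  apply: (@second_derivative_ge0 (fun t => H (horizontal z t))
    (fun t => phix (horizontal z t) + (- (complex.Re z + t) + 2^-1 * (complex.Re (z - z0) + t))) _ e e0).
  - move=> t te; have zt := nearz t%:C; rewrite hxE in zt.
    have dphi : is_derive t 1 (fun t => phi (horizontal z t)) (phix (horizontal z t)).
      apply: is_derive_shift0; have := phi_x (far _ (zt te)).
      by congr is_derive; apply/funext => x; rewrite horizontalD.
    have := is_deriveD dphi (is_derive_quad_diff 0 (complex.Re z) (complex.Re (z - z0))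
      (complex.Im z ^+ 2) (complex.Im (z - z0) ^+ 2) t).
    congr is_derive; apply/funext => x; rewrite !fctE /H horizontalB !sqr_normcE.
    by rewrite add0r addrA !Re_horizontal !Im_horizontal.
  - have := is_deriveD (phi_xx zfar)
      (is_derive_lin_diff (complex.Re z) (complex.Re (z - z0))).
    exact.
  - move=> t te; have -> : horizontal z 0 = z by rewrite /horizontal addr0.
    by apply: zmin; apply: nearz; rewrite hxE.
have dyy : 0 <= phiyy z - 2^-1.
  apply: (@second_derivative_ge0 (fun t => H (vertical z t))
    (fun t => phiy (vertical z t) + (- (complex.Im z + t) + 2^-1 * (complex.Im (z - z0) + t))) _ e e0).
  - move=> t te; have zt := nearz (t *i); rewrite hyE in zt.
    have dphi : is_derive t 1 (fun t => phi (vertical z t)) (phiy (vertical z t)).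
      apply: is_derive_shift0; have := phi_y (far _ (zt te)).
      by congr is_derive; apply/funext => x; rewrite verticalD.
    have := is_deriveD dphi (is_derive_quad_diff 0 (complex.Im z) (complex.Im (z - z0))
      (complex.Re z ^+ 2) (complex.Re (z - z0) ^+ 2) t).
    congr is_derive; apply/funext => x; rewrite !fctE /H verticalB !sqr_normcE.
    rewrite add0r addrA !Re_vertical !Im_vertical.
    by rewrite [complex.Re z ^+ 2 + _]addrC [complex.Re (z - z0) ^+ 2 + _]addrC.
  - have := is_deriveD (phi_yy zfar)
      (is_derive_lin_diff (complex.Im z) (complex.Im (z - z0))).
    exact.
  - move=> t te; have -> : vertical z 0 = z.
      by rewrite vertical_ReIm addr0; case: (z).
    by apply: zmin; apply: nearz; rewrite hyE.
by have := lap _ ps; lra.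
Qed.

End MinimumPrinciple.

Arguments plane {R}.

(** * Holomorphic maps from the exterior of a disc to the ball *)

Section ExteriorOfDisc.
Variable R : realType.
Local Notation C := R[i].
Variables (rr : R) (F u : C -> nat -> C) (lam : C -> R).
Hypothesis rr0 : 0 <= rr.
Hypothesis F1 : forall z, rr < normc z -> (sqnorm (F z) < 1)%E.
Hypothesis ufin : forall z, rr < normc z -> (sqnorm (u z) < +oo)%E.
Hypothesis dF : forall j z, rr < normc z -> is_derive z 1 (F^~ j) (u z j).
Hypothesis lamE : forall z, rr < normc z -> lam z = hyp_metric (F z) (u z) (u z).
Hypothesis lam_continuous : forall p, rr < normc (plane p) ->
  {for p, continuous (lam \o plane)}.

Lemma normcB_ge (x y : C) : normc x - normc y <= normc (x + y).
Proof.
have := normc_triangle (x + y) (- y); rewrite normc_opp addrK; lra.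
Qed.

Lemma pullback_metric_bounded (z0 : C) (r : R) : r < normc z0 - rr ->
  exists B : R, forall z, normc (z - z0) <= r -> lam z <= B.
Proof.
move=> rz; have [r0|r0] := ltP r 0.
  exists 0 => z zr; have := normc_ge0 (z - z0); lra.
have cl : {within closed_disc z0 r, continuous (lam \o plane)}.
  apply: continuous_in_subspaceT => p; rewrite inE => pr.
  apply: lam_continuous; have := normcB_ge z0 (plane p - z0).
  by rewrite [z0 + _]addrC subrK; move: pr; rewrite /closed_disc /=; lra.
have ne : closed_disc z0 r !=set0.
  exists (complex.Re z0, complex.Im z0); rewrite /closed_disc /=.
  have -> : plane (complex.Re z0, complex.Im z0) - z0 = 0.
    by rewrite /plane; case: (z0) => x y /=; rewrite subrr.
  by rewrite normc0.
have [p _ pmax] := compact_EVT_max ne (@closed_disc_compact R z0 r) cl.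
exists (lam (plane p)) => z zr.
have := pmax (complex.Re z, complex.Im z).
rewrite inE /closed_disc /= /plane /=; case: z zr => x y /= zr; exact.
Qed.

(** The derivatives of the components of F are locally bounded because their squares
    are bounded by the continuous function lam, which makes F holomorphic in the
    sense needed for the Schwarz lemma. *)
Lemma pullback_metric_decay (z0 : C) (s : R) : 0 < s -> s < normc z0 - rr ->
  lam z0 <= 5 / s ^+ 2.
Proof.
move=> s0 sz.
have z0rr : rr < normc z0 by lra.
have near0 (y : C) : normc y < normc z0 - rr -> rr < normc (z0 + y).
  by move=> ys; have := normcB_ge z0 y; lra.
rewrite lamE// -[z0]addr0.
apply: (@hyp_metric_schwarz R (normc z0 - rr) s (fun y => F (z0 + y))
  (fun y => u (z0 + y))).
- by rewrite s0.
- move=> j r rz; have [B BP] := pullback_metric_bounded rz.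
  exists (Num.max 1 (1 + B)) => y yr.
  have yrr : rr < normc (z0 + y) by apply: near0; exact: le_lt_trans rz.
  split.
  + exact: (@is_derive_addl_comp R (F^~ j) z0 y _ (dF j yrr)).
  + have : normc (F (z0 + y) j) ^+ 2 <= 1.
      have Fy := F1 yrr; have Ffin : (sqnorm (F (z0 + y)%R) < +oo)%E by rewrite (lt_trans Fy) ?ltry.
      apply: le_trans (ltW (fine_sqnorm_lt1 Fy)).
      exact: sqr_normc_le_sqnorm.
    rewrite expr_le1 ?normc_ge0// => h.
    by rewrite le_max h.
  + have := sqr_normc_le_hyp_metric j (F1 yrr) (ufin yrr).
    rewrite -lamE// => h; rewrite le_max; apply/orP; right.
    have yz : normc (z0 + y - z0) <= r by rewrite addrAC subrr add0r.
    have := le_trans h (BP _ yz).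
    have := sqr_ge0 (normc (u (z0 + y) j) - 1); have := normc_ge0 (u (z0 + y) j).
    rewrite sqrrB; move: (normc (u _ _)) => N; nra.
- by move=> y ys; apply/F1/near0.
- by rewrite addr0; exact: ufin.
Qed.

Variables (phi phix phiy phixx phiyy : C -> R).
Hypothesis phi_continuous : forall p, rr < normc (plane p) ->
  {for p, continuous (phi \o plane)}.
Hypothesis phi_x : forall z, rr < normc z ->
  is_derive (0 : R) 1 (fun t => phi (horizontal z t)) (phix z).
Hypothesis phi_y : forall z, rr < normc z ->
  is_derive (0 : R) 1 (fun t => phi (vertical z t)) (phiy z).
Hypothesis phi_xx : forall z, rr < normc z ->
  is_derive (0 : R) 1 (fun t => phix (horizontal z t)) (phixx z).
Hypothesis phi_yy : forall z, rr < normc z ->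
  is_derive (0 : R) 1 (fun t => phiy (vertical z t)) (phiyy z).
Hypothesis lam_laplacian : forall z, rr < normc z ->
  lam z = 4^-1 * (phixx z + phiyy z).

(** At distance X from the origin, discs of radius X / 4 stay far from the excluded
    disc; there lam = O(1 / X^2), and [laplacian_min_principle] bounds X^2 by a
    multiple of K. *)
Lemma no_flat_exterior (K rho : R) :
  ~ (forall z, rr < normc z -> rho < normc z ->
      `|phi z - 2^-1 * normc z ^+ 2| <= K).
Proof.
move=> growth; have rr_ge0 := rr0.
(* X >= 20 makes 5 / (X / 4)^2 < 1 / 4; the other terms keep the disc in the region
   where phi is controlled and make (X / 4)^2 larger than 8 K. *)
pose X := 20 + 4 * rr + 2 * `|rho| + 128 * `|K|.
have X20 : 20 <= X by rewrite /X; have := normr_ge0 rho; have := normr_ge0 K; lra.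
have Xrr : 4 * rr < X by rewrite /X; have := normr_ge0 rho; have := normr_ge0 K; lra.
have Xrho : 2 * rho < X by rewrite /X; have := ler_norm rho; have := normr_ge0 rho; have := normr_ge0 K; lra.
have XK : 128 * K < X by rewrite /X; have := ler_norm K; have := normr_ge0 rho; have := normr_ge0 K; lra.
have nX : normc X%:C = X by rewrite normc_real ger0_norm//; lra.
have far z : normc (z - X%:C) <= X / 4 -> 3 / 4 * X <= normc z.
  by move=> zs; have := normcB_ge X%:C (z - X%:C); rewrite [X%:C + _]addrC subrK nX; lra.
have : (X / 4) ^+ 2 <= 8 * K.
  apply: (laplacian_min_principle phi_continuous phi_x phi_y phi_xx phi_yy (z0 := X%:C)).
  - lra.
  - by rewrite nX; lra.
  - by move=> z /far zf; apply: growth; lra.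
  - move=> z /far zf.
    have zrr : rr < normc z by lra.
    have : lam z <= 5 / (X / 4) ^+ 2 by apply: pullback_metric_decay; lra.
    have : 5 / (X / 4) ^+ 2 < 4^-1.
      by rewrite ltr_pdivrMr ?exprn_gt0//; nra.
    rewrite lam_laplacian//; lra.
by have : 0 <= `|K| := normr_ge0 K; nra.
Qed.

End ExteriorOfDisc.

(** * Derivatives of maps into l^2 along a holomorphic curve *)

Section ImmersionAlongLine.
Variable R : realType.
Local Notation C := R[i].

Lemma complex_is_derive_nearP (H : C -> C) (z d : C) :
  is_derive z 1 H d <->
  forall e : R, 0 < e -> \forall h \near (0 : C),
    normc (H (z + h) - H z - d * h) <= e * normc h.
Proof.
split=> [dH e e0|HP].
  have [r r0 rP] := complex_is_derive_estimate e0 dH.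
  apply/nbhs_normP; exists r%:C => /=; first by rewrite ltcR.
  by move=> h; rewrite /ball_ /= sub0r normrN normcR ltcR => /rP.
apply: complex_is_derive_of_estimate => e e0.
have /nbhs_normP[r /= r0 rP] := HP e e0.
have rE : r = (complex.Re r)%:C by rewrite RRe_real// gtr0_real.
exists (complex.Re r); first by rewrite -ltcR -rE.
move=> h hr; apply: rP.
by rewrite /ball_ /= sub0r normrN rE normcR ltcR.
Qed.

Lemma is_derive_coord n (G : C -> 'rV[C]_n) (z : C) (D : 'rV[C]_n) k :
  is_derive z 1 G D -> is_derive z 1 (fun s => G s 0 k) (D 0 k).
Proof.
move=> dG.
have cG : h^-1 *: (G (h *: 1 + z) - G z) @[h --> 0^'] --> D.
  by rewrite -(@derive_val _ _ _ _ _ _ _ dG); exact: (@ex_derive _ _ _ _ _ _ _ dG).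
have ck : h^-1 *: (G (h *: 1 + z) 0 k - G z 0 k) @[h --> 0^'] --> D 0 k.
  have := cvg_comp _ _ cG (@coord_continuous C 1 n 0 k D).
  apply: cvg_trans; apply: near_eq_cvg; near=> h.
  by rewrite /= !mxE.
apply: DeriveDef; first by apply/cvg_ex; exists (D 0 k); exact: ck.
by apply/cvg_lim; [exact: norm_hausdorff|exact: ck].
Unshelve. all: by end_near. Qed.

Lemma sqnorm_le_coord (w : nat -> C) (c : R) j :
  (sqnorm w <= c%:E)%E -> normc (w j) ^+ 2 <= c.
Proof.
move=> wc; have wfin : (sqnorm w < +oo)%E by rewrite (le_lt_trans wc) ?ltry.
rewrite (le_trans (sqr_normc_le_sqnorm j wfin))// -lee_fin fineK//.
by rewrite ge0_fin_numE ?sqnorm_ge0.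
Qed.

Lemma normc_le_sum (T : finType) (f : T -> C) :
  normc (\sum_k f k) <= \sum_k normc (f k).
Proof.
elim/big_ind2 : _ => //; first by rewrite normc0.
by move=> x1 x2 y1 y2 h1 h2; exact: normcD_le.
Qed.

Lemma enorm_sqr n (v : 'rV[C]_n) : enorm v ^+ 2 = \sum_k normc (v 0 k) ^+ 2.
Proof.
rewrite /enorm sqr_sqrtr.
  by apply: eq_bigr => k _; rewrite sqr_normcE !expr2.
by apply: sumr_ge0 => k _; rewrite addr_ge0// -expr2 sqr_ge0.
Qed.

Lemma near_shift0 (z : C) (P : set C) :
  nbhs z P -> \forall h \near (0 : C), P (z + h).
Proof.
move=> /nbhs_normP[r r0 rP]; apply/nbhs_normP; exists r => // h.
rewrite /ball_ /= sub0r normrN => hr; apply: rP.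
by rewrite /ball_ /= opprD addrA subrr sub0r normrN.
Qed.

(** The increment of F after G is L of the increment of G, up to the l^2 error.  The
    error of G with respect to its derivative stays small under the j-th component
    of L, a linear form determined by its values on the basis vectors. *)
Lemma l2_differential_comp n (F : 'rV[C]_n -> nat -> C)
    (L : 'rV[C]_n -> nat -> C) (G : C -> 'rV[C]_n) (z : C) (D : 'rV[C]_n) j :
  l2_differential F (G z) L -> is_derive z 1 G D ->
  is_derive z 1 (fun s => F (G s) j) (L D j).
Proof.
move=> [Llin _ LF] dG.
have L0 : L 0 = 0.
  have := Llin (-1) 0 0; rewrite scaler0 add0r => h.
  by apply/eqP; rewrite -subr_eq0 {1}h scaleN1r addNr sub0r oppr_eq0; apply/eqP;
     move: h; rewrite scaleN1r addNr.
have LD (a b : 'rV[C]_n) : L (a + b) = L a + L b.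
  by have := Llin 1 a b; rewrite !scale1r.
have LZ (c : C) (a : 'rV[C]_n) : L (c *: a) = c *: L a.
  by have := Llin c a 0; rewrite L0 !addr0.
have LE (v : 'rV[C]_n) : L v j = \sum_k v 0 k * L (delta_mx 0 k) j.
  rewrite {1}[v]row_sum_delta (big_morph L LD L0) fct_sumE.
  by apply: eq_bigr => k _; rewrite LZ.
pose S := \sum_k normc (L (delta_mx 0 k) j).
pose M := \sum_k (normc (D 0 k) + 1) ^+ 2.
have S0 : 0 <= S by apply: sumr_ge0 => k _; exact: normc_ge0.
have M0 : 0 <= M by apply: sumr_ge0 => k _; exact: sqr_ge0.
apply/complex_is_derive_nearP => e e0.
pose e1 := (e / 2) ^+ 2 / (M + 1).
pose e2 := e / 2 / (S + 1).
have e10 : 0 < e1 by rewrite divr_gt0 ?exprn_gt0 ?divr_gt0// ltr_wpDl.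
have e20 : 0 < e2 by rewrite !divr_gt0// ltr_wpDl.
have cG : {for z, continuous G}.
  exact/differentiable_continuous/derivable1_diffP/(@ex_derive _ _ _ _ _ _ _ dG).
have FF : Filter (nbhs (0 : C)) := @nbhs_filter _ (0 : C).
have near1 := near_shift0 (cG _ (LF e1 e10)).
have near2 : \forall h \near (0 : C), forall k,
    normc (G (z + h) 0 k - G z 0 k - D 0 k * h) <= 1 * normc h.
  apply: (@filter_forall C _ _ (nbhs (0 : C)) FF) => k.
  exact: (iffLR (complex_is_derive_nearP _ _ _) (is_derive_coord k dG) 1 ltr01).
have near3 : \forall h \near (0 : C), forall k,
    normc (G (z + h) 0 k - G z 0 k - D 0 k * h) <= e2 * normc h.
  apply: (@filter_forall C _ _ (nbhs (0 : C)) FF) => k.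
  exact: (iffLR (complex_is_derive_nearP _ _ _) (is_derive_coord k dG) e2 e20).
near=> h.
have h1 : (sqnorm (F (G (z + h)) - F (G z) - L (G (z + h) - G z))%R
    <= (e1 * enorm (G (z + h) - G z) ^+ 2)%:E)%E by near: h; exact: near1.
have h2 k : normc (G (z + h) 0 k - G z 0 k - D 0 k * h) <= 1 * normc h.
  by move: k; near: h; exact: near2.
have h3 k : normc (G (z + h) 0 k - G z 0 k - D 0 k * h) <= e2 * normc h.
  by move: k; near: h; exact: near3.
have enM : enorm (G (z + h) - G z) ^+ 2 <= M * normc h ^+ 2.
  rewrite enorm_sqr /M mulr_suml; apply: ler_sum => k _; rewrite -exprMn.
  rewrite ler_sqr ?nnegrE ?normc_ge0// ?mulr_ge0 ?normc_ge0 ?addr_ge0 ?normc_ge0//.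
  rewrite !mxE.
  have -> : G (z + h) 0 k - G z 0 k =
      D 0 k * h + (G (z + h) 0 k - G z 0 k - D 0 k * h) by ring.
  rewrite (le_trans (normc_triangle _ _))// normcM mulrDl lerD2l.
  exact: h2.
have p1 : normc ((F (G (z + h)) - F (G z) - L (G (z + h) - G z)) j) <= e / 2 * normc h.
  rewrite -ler_sqr ?nnegrE ?normc_ge0 ?mulr_ge0 ?normc_ge0 ?divr_ge0 ?(ltW e0)//.
  rewrite (le_trans (sqnorm_le_coord j h1))//.
  rewrite (le_trans (ler_wpM2l (ltW e10) enM))// exprMn mulrA ler_wpM2r ?sqr_ge0//.
  rewrite /e1 mulrAC ler_pdivrMr ?ltr_wpDl// ler_wpM2l ?sqr_ge0// lerDl ler01//.
have p2 : normc (L (G (z + h) - G z - h *: D) j) <= e / 2 * normc h.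
  rewrite LE (le_trans (normc_le_sum _))//.
  apply: (@le_trans _ _ (\sum_k (e2 * normc h) * normc (L (delta_mx 0 k) j))).
    apply: ler_sum => k _; rewrite normcM ler_wpM2r ?normc_ge0//.
    by have := h3 k; rewrite !mxE [h * _]mulrC.
  rewrite -mulr_sumr -/S mulrAC ler_wpM2r ?normc_ge0//.
  by rewrite /e2 mulrAC ler_pdivrMr ?ltr_wpDl// ler_wpM2l ?divr_ge0 ?(ltW e0)// lerDl ler01.
have LB : L (G (z + h) - G z - h *: D) = L (G (z + h) - G z) - h *: L D.
  by rewrite -scaleNr (LD (G (z + h) - G z)) LZ scaleNr.
have -> : F (G (z + h)) j - F (G z) j - L D j * h =
   (F (G (z + h)) - F (G z) - L (G (z + h) - G z)) j + L (G (z + h) - G z - h *: D) j.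
  rewrite LB !fctE -[h *: L D j]/(h * L D j); ring.
by rewrite (le_trans (normcD_le p1 p2))// -mulrDl -splitr.
Unshelve. all: by end_near. Qed.

End ImmersionAlongLine.

(** * The immersion along a complex line of an end *)

Section EndOfManifold.
Variable R : realType.
Local Notation C := R[i].

Lemma curve_deriv_horizontal (z : C) : curve_deriv (horizontal z) 0 1.
Proof.
move=> e e0; apply/nbhs_normP; exists 1 => //= s _.
have -> : horizontal z (0 + s) - horizontal z 0 - s%:C * 1 = 0.
  by rewrite add0r /horizontal mulr1 addr0; ring.
by rewrite normc0 mulr_ge0// ltW.
Qed.

(** Pullbacks are defined by real partial derivatives of real and imaginary parts;
    along the line these are the parts of one complex derivative. *)
Lemma vder_line n (h : 'rV[C]_n -> 'rV[C]_n) (v D : 'rV[C]_n) (z : C) :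
  is_derive z 1 (fun s => h (s *: v)) D -> vder h (z *: v) v = D.
Proof.
move=> dG; apply/rowP => k; rewrite mxE.
have dk : curve_deriv (fun t => h (horizontal z t *: v) 0 k) 0 (D 0 k).
  have d0 : is_derive (horizontal z 0) 1 (fun s => h (s *: v) 0 k) (D 0 k).
    by rewrite /horizontal addr0; exact: (is_derive_coord k dG).
  rewrite -[D 0 k]mulr1.
  exact: (curve_deriv_comp (curve_deriv_horizontal z) d0).
have [dRe dIm] := iffLR (curve_derivP _ _ _) dk.
rewrite !ddirE !derive1E.
have lineE (t : R) : z *: v + t%:C *: v = horizontal z t *: v by rewrite -scalerDl.
under eq_fun do rewrite lineE.
have -> : (fun t : R => complex.Im (h (z *: v + t%:C *: v) 0 k)) =
    (fun t : R => complex.Im (h (horizontal z t *: v) 0 k)).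
  by apply/funext => t; rewrite lineE.
by rewrite !derive_val; case: (D 0 k).
Qed.

(** In a chart around the image point the immersion is composed of a chart
    expression of E and of a map with l^2 differential L; w is the image by L of the
    tangent vector of the line. *)
Lemma immersion_line_derivative n (M : complexManifold R n) (g : kahlerMetric M)
    (N : option nat) (f : M -> nat -> C) (E : 'rV[C]_n -> M) (U : set 'rV[C]_n)
    (h : 'rV[C]_n -> 'rV[C]_n -> 'rV[C]_n -> R) (v : 'rV[C]_n) (z : C) :
  kahler_immersion g N f -> holomorphic_on U E -> is_pullback g E U h ->
  U (z *: v) -> E @ (z *: v) --> E (z *: v) ->
  exists w : nat -> C,
  [/\ (sqnorm w < +oo)%E,
      (forall j, is_derive z 1 (fun s => f (E (s *: v)) j) (w j)) &
      h (z *: v) v v = hyp_metric (f (E (z *: v))) w w].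
Proof.
move=> [_ imm] holE pull Uz cE.
have [i di] := dom_cover (E (z *: v)).
have [|L Ldiff gL] := imm i (chart i (E (z *: v))); first by exists (E (z *: v)).
pose G (s : C) := (chart i \o E) (s *: v).
have dG : derivable G z 1.
  apply/derivable1_diffP.
  apply: (@differentiable_comp _ _ _ _ (fun s : C => s *: v) (chart i \o E)).
    exact: ex_diff.
  exact: holE.
pose D := 'D_1 G z.
have {}dG : is_derive z 1 G D by apply: DeriveDef.
have TD : vder (chart i \o E) (z *: v) v = D by exact: vder_line.
exists (L D); split.
- by case: Ldiff.
- move=> j.
  have := @l2_differential_comp R n (f \o chart_inv i) L G z D j Ldiff dG.
  apply: near_eq_is_derive.
  have cs : {for z, continuous (fun s : C => s *: v)} by exact: scalel_continuous.
  have := cs _ (cE _ (open_nbhs_nbhs (conj (dom_open i) di))).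
  apply: (@filterS C (nbhs z) (@nbhs_filter _ z)) => s ds.
  by rewrite /= /G /= chartK.
- rewrite (pull i (z *: v) v v Uz di) TD gL.
  by rewrite chartK.
Qed.

End EndOfManifold.

(** * Ends with a flat potential are not immersible *)

Section NoImmersion.
Variable R : realType.
Local Notation C := R[i].

Lemma enorm_line n (k : 'I_n) (z : C) : enorm (z *: (delta_mx 0 k : 'rV[C]_n)) = normc z.
Proof.
apply/eqP; rewrite -(@eqrXn2 _ 2) ?normc_ge0 ?sqrtr_ge0// enorm_sqr.
rewrite (bigD1 k)//= big1 ?addr0; last first.
  by move=> j jk; rewrite !mxE (negbTE jk) andbF mulr0 normc0 expr0n.
by rewrite !mxE !eqxx mulr1.
Qed.

Lemma is_derive_ddir (V : lmodType R[i]) (p : V -> R) (x v : V) :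
  derivable (fun t : R => p (x + t%:C *: v)) 0 1 ->
  is_derive (0 : R) 1 (fun t => p (x + t%:C *: v)) (ddir p x v).
Proof. by move=> dp; apply: DeriveDef => //; rewrite ddirE derive1E. Qed.

Lemma line_plane_continuous n (v : 'rV[C]_n) (q : 'rV[C]_n -> R) (p : R * R) :
  q @ (plane p *: v) --> q (plane p *: v) ->
  {for p, continuous ((fun z => q (z *: v)) \o plane)}.
Proof.
move=> cq.
have cs : {for plane p, continuous (fun s : C => s *: v)} by exact: scalel_continuous.
have cp := @plane_continuous R p.
exact: (cvg_comp _ _ (cvg_comp _ _ cp cs) cq).
Qed.

(** Restriction of the immersion and of the potential to the k-th coordinate axis of the
    asymptotic chart, where [no_flat_exterior] applies. *)
Lemma end_not_immersible n (M : complexManifold R n) (g : kahlerMetric M)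
    (N : option nat) (f : M -> nat -> C) (E : 'rV[C]_n -> M) (r : R)
    (P : 'rV[C]_n -> R) (k : 'I_n) (K rho : R) :
  kahler_immersion g N f -> 0 < r ->
  holomorphic_on (exterior r) E ->
  (forall x, exterior r x -> E @ x --> E x) ->
  smooth (exterior r) P ->
  is_pullback g E (exterior r) (levi P) ->
  ~ (forall x, exterior r x -> rho < enorm x ->
      `|P x - 2^-1 * enorm x ^+ 2| <= K).
Proof.
move=> imm r0 holE cE sP pull growth.
pose v : 'rV[C]_n := delta_mx 0 k.
have Uz z : r < normc z -> exterior r (z *: v) by rewrite /exterior /= enorm_line.
have [w wP] : exists w : C -> nat -> C, forall z, r < normc z ->
    [/\ (sqnorm (w z) < +oo)%E,
      (forall j, is_derive z 1 (fun s => f (E (s *: v)) j) (w z j)) &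
      levi P (z *: v) v v = hyp_metric (f (E (z *: v))) (w z) (w z)].
  have /choice[w wP] : forall z, exists w, r < normc z ->
      [/\ (sqnorm w < +oo)%E,
      (forall j, is_derive z 1 (fun s => f (E (s *: v)) j) (w j)) &
      levi P (z *: v) v v = hyp_metric (f (E (z *: v))) w w].
    move=> z; have [rz|zr] := ltP r (normc z); last first.
      by exists (fun=> 0).
    have [w wP] := immersion_line_derivative imm holE pull (Uz _ rz) (cE _ (Uz _ rz)).
    by exists w.
  by exists w.
have hE z t : horizontal z t *: v = z *: v + t%:C *: v by rewrite -scalerDl.
have vE z t : vertical z t *: v = z *: v + t%:C *: ('i%C *: v).
  rewrite scalerA -scalerDl; congr (_ *: _); rewrite /vertical; congr (_ + _).
  by apply/eqP; rewrite eq_complex /= !mulr0 !mul0r mulr1 subr0 addr0 !eqxx.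
have d1 x u : exterior r x -> is_derive (0 : R) 1 (fun t => P (x + t%:C *: u)) (ddir P x u).
  by move=> Ux; apply: is_derive_ddir; exact: (sP 1).1.
have d2 x u u' : exterior r x ->
    is_derive (0 : R) 1 (fun t => ddir P (x + t%:C *: u') u)
      (ddir (fun y => ddir P y u) x u').
  by move=> Ux; apply: is_derive_ddir; exact: ((sP 2).2 u).1.
have c2 x u u' : exterior r x -> (fun y => ddir (fun y => ddir P y u) y u') @ x -->
    ddir (fun y => ddir P y u) x u'.
  by move=> Ux; exact: ((sP 2).2 u).2.
apply: (@no_flat_exterior R r (fun z => f (E (z *: v))) w
  (fun z => levi P (z *: v) v v) (ltW r0) _ _ _ _ _
  (fun z => P (z *: v)) (fun z => ddir P (z *: v) v)
  (fun z => ddir P (z *: v) ('i%C *: v))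
  (fun z => ddir (fun y => ddir P y v) (z *: v) v)
  (fun z => ddir (fun y => ddir P y ('i%C *: v)) (z *: v) ('i%C *: v))
  _ _ _ _ _ _ K rho).
- by move=> z rz; have [/(_ (E (z *: v)))[]] := imm.
- by move=> z /wP[].
- by move=> j z /wP[].
- by move=> z /wP[].
- move=> p rp.
  have A1 := line_plane_continuous (c2 _ v v (Uz _ rp)).
  have A2 := line_plane_continuous (c2 _ ('i%C *: v) ('i%C *: v) (Uz _ rp)).
  by apply: cvgM; [exact: cvg_cst|exact: (cvgD A1 A2)].
- by move=> p rp; apply: line_plane_continuous; apply: (sP 0); exact: Uz.
- move=> z rz; under eq_fun do rewrite hE; exact/d1/Uz.
- move=> z rz; under eq_fun do rewrite vE; exact/d1/Uz.
- move=> z rz; under eq_fun do rewrite hE; exact/d2/Uz.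
- move=> z rz; under eq_fun do rewrite vE; exact/d2/Uz.
- by [].
- by move=> z rz rhoz; have := growth _ (Uz _ rz); rewrite enorm_line; exact.
Qed.

Lemma asymptotic_potential_bound (a alpha C0 t P : R) : 0 < alpha -> 1 <= t ->
  `|P - (2^-1 * t ^+ 2 + a * t `^ (- 2 * alpha))| <= C0 * t `^ (- 2 * alpha - 1) ->
  `|P - 2^-1 * t ^+ 2| <= `|a| + `|C0|.
Proof.
move=> alpha0 t1 h.
have pow_le1 (b : R) : b <= 0 -> t `^ b <= 1.
  by move=> b0; rewrite -(powRr0 t) ler_powR.
have -> : P - 2^-1 * t ^+ 2 = a * t `^ (- 2 * alpha)
   + (P - (2^-1 * t ^+ 2 + a * t `^ (- 2 * alpha))) by ring.
rewrite (le_trans (ler_normD _ _))// lerD//.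
  by rewrite normrM ler_piMr// ger0_norm ?powR_ge0// pow_le1//; lra.
rewrite (le_trans h)// (le_trans (ler_norm _))// normrM ler_piMr//.
by rewrite ger0_norm ?powR_ge0// pow_le1//; lra.
Qed.

Lemma exterior_dim_gt0 n (r : R) (x : 'rV[C]_n) : 0 <= r ->
  exterior r x -> exists k : 'I_n, True.
Proof.
move=> r0; case: n x => [|n] x Ux; last by exists ord0.
move: Ux; rewrite /exterior /= ltNge => /negP[].
by rewrite /enorm /dotR big_ord0 sqrtr0.
Qed.

(** Since M is not compact, there is at least one end; a point in it also shows that
    the dimension is positive. *)
Lemma no_kahler_immersion n (M : complexManifold R n) (g : kahlerMetric M)
    (a alpha : R) (N : option nat) :
  ALE g -> 0 < alpha -> has_asymptotic_potential g a alpha ->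
  ~ exists f, kahler_immersion g N f.
Proof.
move=> [_ ncM _ _ _] alpha0 [K [m [E [r [G [Phi [ends pot]]]]]]] [f imm].
have [cK rP lE _ KP] := ends.
have [p Kp] : exists p, ~ K p.
  apply: contrapT => allK; apply: ncM.
  suff <- : K = setT by [].
  by apply/seteqP; split=> // p _; apply: contrapT => Kp; apply: allK; exists p.
have [j [x Ux _]] := iffLR (KP p) Kp.
have [r0 _] := rP j.
have [k _] := exterior_dim_gt0 (ltW r0) Ux.
have [holE sP pull [C0 [rho bound]]] := pot j.
have cE y : exterior (r j) y -> E j @ y --> E j y by move=> Uy; case: (lE j y Uy).
apply: (@end_not_immersible n M g N f (E j) (r j) (Phi \o E j) k
  (`|a| + `|C0|) (Num.max 1 rho) imm r0 holE cE sP pull) => y Uy.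
rewrite gt_max => /andP[y1 yrho].
exact: (asymptotic_potential_bound alpha0 (ltW y1) (bound y Uy yrho)).
Qed.

End NoImmersion.

Theorem theorem3p4 (R : realType) (n : nat) (M : complexManifold R n)
    (g : kahlerMetric M) (a alpha : R) (N : option nat) :
  ALE g ->
  0 < alpha ->
  has_asymptotic_potential g a alpha ->
  [/\ 0 < mass g -> ~ (exists f, kahler_immersion g N f),
      mass g = 0 -> ~ (exists f, kahler_immersion g N f) &
      mass g < 0 -> ~ (exists f, kahler_immersion g N f)].
Proof.
by move=> aleg alpha0 pot; have no := no_kahler_immersion aleg alpha0 pot; split.
Qed.
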